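(* The variety of complex $4$-dimensional nilpotent mono Leibniz algebras has dimension $15$ and has exactly three irreducible components, $\overline{O(\mathfrak{L}_2)}$, $\overline{O(\mathbb{M}_{12}^{\alpha})}$ and $\overline{O(\mathbb{M}_{14}^{\alpha})}$, where on a basis $e_1,\dots,e_4$ (products not listed are zero, $\alpha\in\mathbb{C}$): $\mathfrak{L}_2$: $e_1e_1=e_2,\ e_2e_1=e_3,\ e_3e_1=e_4$; $\mathbb{M}_{12}^{\alpha}$: $e_1e_1=\alpha e_4,\ e_1e_2=e_3,\ e_1e_3=e_4,\ e_2e_1=-e_3,\ e_2e_2=e_4,\ e_3e_1=-e_4,\ e_3e_3=e_4$; $\mathbb{M}_{14}^{\alpha}$: $e_1e_1=e_3,\ e_1e_2=e_3,\ e_2e_1=e_4,\ e_2e_2=\alpha e_3,\ e_3e_2=e_4$. In particular, there is exactly one rigid algebra in this variety.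
   Context: An algebra is a Leibniz algebra if it satisfies $(xy)z=(xz)y+x(yz)$; it is a mono Leibniz algebra if every subalgebra generated by one element is a Leibniz algebra; it is nilpotent if for some $n$ every product of $n$ elements (any bracketing) vanishes. Fix an $n$-dimensional complex vector space $V$; algebra structures on $V$ are bilinear maps $V\times V\to V$, identified with their structure constants in $\mathbb{C}^{n^3}$. Structures satisfying given polynomial identities form an affine variety on which $GL(V)$ acts by $(g*\mu)(x,y)=g\mu(g^{-1}x,g^{-1}y)$; orbits are isomorphism classes. For a parametric family, $\overline{O(\cdot)}$ denotes the Zariski closure of the union of the orbits of all members. An algebra is rigid if its orbit is Zariski-open in the variety. The dimension of the variety is the maximum dimension of its irreducible components. *)

(* Defs.v *)
(* The ground field is C := R[i] (mathcomp-real-closed's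
   complex numbers) for an arbitrary R : realType, i.e. the complex numbers. *)
From HB Require Import structures.
From mathcomp Require Import all_boot all_order all_algebra.
From mathcomp Require Import reals complex.
Set Implicit Arguments. Unset Strict Implicit. Unset Printing Implicit Defensive.
Import Order.TTheory GRing.Theory Num.Theory.
Local Open Scope ring_scope.

Inductive polyfun (F : nzRingType) (I : Type) : ((I -> F) -> F) -> Prop :=
| pf_const (c : F) : polyfun (fun _ => c)
| pf_coord (i : I) : polyfun (fun x => x i)
| pf_add f g : polyfun f -> polyfun g -> polyfun (fun x => f x + g x)
| pf_mul f g : polyfun f -> polyfun g -> polyfun (fun x => f x * g x).

Definition zclosed (F : nzRingType) (I : Type) (S : (I -> F) -> Prop) : Prop :=
  exists P : ((I -> F) -> F) -> Prop,
    (forall f, P f -> polyfun f) /\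
    (forall x, S x <-> (forall f, P f -> f x = 0)).

Definition subset_of (T : Type) (A B : T -> Prop) := forall x, A x -> B x.

Definition zclosure (F : nzRingType) (I : Type) (A : (I -> F) -> Prop) :
  (I -> F) -> Prop :=
  fun x => forall S, zclosed S -> subset_of A S -> S x.

Definition zirreducible (F : nzRingType) (I : Type) (Y : (I -> F) -> Prop) : Prop :=
  zclosed Y /\ (exists x, Y x) /\
  (forall A B : (I -> F) -> Prop, zclosed A -> zclosed B ->
     subset_of Y (fun x => A x \/ B x) -> subset_of Y A \/ subset_of Y B).

Definition zcomponent (F : nzRingType) (I : Type) (X Y : (I -> F) -> Prop) : Prop :=
  zirreducible Y /\ subset_of Y X /\
  (forall Z, zirreducible Z -> subset_of Y Z -> subset_of Z X -> Z = Y).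

Definition zchain (F : nzRingType) (I : Type) (Y : (I -> F) -> Prop) (d : nat) : Prop :=
  exists Z : nat -> (I -> F) -> Prop,
    (forall k, (k <= d)%N -> zirreducible (Z k)) /\
    (forall k, (k < d)%N -> subset_of (Z k) (Z k.+1) /\ Z k <> Z k.+1) /\
    subset_of (Z d) Y.

Definition zdim_irr (F : nzRingType) (I : Type) (Y : (I -> F) -> Prop) (d : nat) : Prop :=
  zchain Y d /\ ~ zchain Y d.+1.

Definition zdim (F : nzRingType) (I : Type) (X : (I -> F) -> Prop) (d : nat) : Prop :=
  (exists Y, zcomponent X Y /\ zdim_irr Y d) /\
  (forall Y d', zcomponent X Y -> zdim_irr Y d' -> (d' <= d)%N).

(* mu (i, j, k) = coefficient of e_k in e_i e_j *)
Definition structure (F : nzRingType) (n : nat) := 'I_n * 'I_n * 'I_n -> F.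
Definition vec (F : nzRingType) (n : nat) := 'I_n -> F.

Definition mulS (F : nzRingType) (n : nat) (mu : structure F n) (x y : vec F n) : vec F n :=
  fun k => \sum_(i < n) \sum_(j < n) x i * y j * mu (i, j, k).

Definition vadd (F : nzRingType) (n : nat) (x y : vec F n) : vec F n := fun k => x k + y k.
Definition vscale (F : nzRingType) (n : nat) (c : F) (x : vec F n) : vec F n := fun k => c * x k.
Definition vzero (F : nzRingType) (n : nat) : vec F n := fun _ => 0.
Definition basis_vec (F : nzRingType) (n : nat) (i : 'I_n) : vec F n :=
  fun k => if k == i then 1 else 0.

Definition leibniz_on (F : nzRingType) (n : nat) (mu : structure F n) (P : vec F n -> Prop) :=
  forall x y z, P x -> P y -> P z ->
    mulS mu (mulS mu x y) z = vadd (mulS mu (mulS mu x z) y) (mulS mu x (mulS mu y z)).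

Definition leibniz (F : nzRingType) (n : nat) (mu : structure F n) :=
  leibniz_on mu (fun _ => True).

Inductive gen_subalg (F : nzRingType) (n : nat) (mu : structure F n) (a : vec F n) :
  vec F n -> Prop :=
| gs_gen : gen_subalg mu a a
| gs_zero : gen_subalg mu a (@vzero F n)
| gs_add x y : gen_subalg mu a x -> gen_subalg mu a y -> gen_subalg mu a (vadd x y)
| gs_scale c x : gen_subalg mu a x -> gen_subalg mu a (vscale c x)
| gs_mul x y : gen_subalg mu a x -> gen_subalg mu a y -> gen_subalg mu a (mulS mu x y).

Definition mono_leibniz (F : nzRingType) (n : nat) (mu : structure F n) :=
  forall a, leibniz_on mu (gen_subalg mu a).

Inductive prods (F : nzRingType) (n : nat) (mu : structure F n) : nat -> vec F n -> Prop :=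
| pr_one x : prods mu 1 x
| pr_mul m1 m2 u v : prods mu m1 u -> prods mu m2 v -> prods mu (m1 + m2) (mulS mu u v).

Definition nilpotent (F : nzRingType) (n : nat) (mu : structure F n) :=
  exists N, (0 < N)%N /\ forall v, prods mu N v -> v = @vzero F n.

Definition NilMonoLeib (F : nzRingType) (n : nat) : structure F n -> Prop :=
  fun mu => mono_leibniz mu /\ nilpotent mu.

Definition appm (F : nzRingType) (n : nat) (g : 'M[F]_n) (v : vec F n) : vec F n :=
  fun k => \sum_(l < n) g k l * v l.

Definition act (F : fieldType) (n : nat) (g : 'M[F]_n) (mu : structure F n) : structure F n :=
  fun '(i, j, k) =>
    appm g (mulS mu (appm (invmx g) (@basis_vec F n i)) (appm (invmx g) (@basis_vec F n j))) k.

Definition gl_orbit (F : fieldType) (n : nat) (mu : structure F n) : structure F n -> Prop :=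
  fun nu => exists g : 'M[F]_n, g \in unitmx /\ nu = act g mu.

Definition family_orbit_closure (F : fieldType) (n : nat) (P : Type)
  (fam : P -> structure F n) : structure F n -> Prop :=
  zclosure (fun nu => exists p, gl_orbit (fam p) nu).

Definition rigid_in (F : fieldType) (n : nat) (X : structure F n -> Prop)
  (mu : structure F n) : Prop :=
  X mu /\ exists S, zclosed S /\ forall nu, gl_orbit mu nu <-> (X nu /\ ~ S nu).

(* ---------- The algebras (basis e_1..e_4 = indices 0..3) ---------- *)
Definition L2 (F : nzRingType) : structure F 4 :=
  fun '(i, j, k) =>
    match nat_of_ord i, nat_of_ord j, nat_of_ord k with
    | 0, 0, 1 => 1 | 1, 0, 2 => 1 | 2, 0, 3 => 1
    | _, _, _ => 0 end.

Definition M12 (F : nzRingType) (a : F) : structure F 4 :=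
  fun '(i, j, k) =>
    match nat_of_ord i, nat_of_ord j, nat_of_ord k with
    | 0, 0, 3 => a | 0, 1, 2 => 1 | 0, 2, 3 => 1 | 1, 0, 2 => -1
    | 1, 1, 3 => 1 | 2, 0, 3 => -1 | 2, 2, 3 => 1
    | _, _, _ => 0 end.

Definition M14 (F : nzRingType) (a : F) : structure F 4 :=
  fun '(i, j, k) =>
    match nat_of_ord i, nat_of_ord j, nat_of_ord k with
    | 0, 0, 2 => 1 | 0, 1, 2 => 1 | 1, 0, 3 => 1 | 1, 1, 2 => a | 2, 1, 3 => 1
    | _, _, _ => 0 end.

(* Main.v *)
(* Every nilpotent structure has a strictly triangular basis, in which the mono Leibniz
   condition (x_i x_j = 0 for the right powers x_1 = x, x_{k+1} = x_k x and j >= 2) becomes a few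
   polynomial equations, whose solutions, up to a change of basis, form three linear spaces T1, T14
   and T12 of structures.  A generic point of each is isomorphic to L2, M14^a, M12^a respectively, so
   the variety is the union of the three closures, each irreducible as the closure of a polynomial
   image.  They are pairwise incomparable by the identities ((xx)x)x = 0, x(yz) = 0,
   (xy)z = (xz)y and (xx)y = 0.  Only L2 is rigid: its orbit is the complement of ((xx)x)x = 0,
   whereas distinct members of M12 and of M14 are not isomorphic.
   A strict chain of irreducible closed sets of length d yields d algebraically independent
   polynomial functions, since a function vanishing on the smaller set but not on the larger one
   can be added at each step.  Each closure is dominated by an affine space of dimension 15, for T14
   and T12 because a generic g in GL_4 is a 5-parameter unipotent matrix times a matrix
   preserving the flag <e_4> < <e_3, e_4>, which acts on the 10-dimensional linear space. *)
Require Import Defs.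
From HB Require Import structures.
From mathcomp Require Import all_boot all_order all_algebra.
From mathcomp Require Import reals complex.
From mathcomp Require Import boolp ring zify.
Set Implicit Arguments. Unset Strict Implicit. Unset Printing Implicit Defensive.
Import Order.TTheory GRing.Theory Num.Theory.
Local Open Scope ring_scope.

(** * Polynomial functions and the Zariski topology *)

(** Density arguments are restricted to a line, where a nonzero one-variable polynomial over a field
    of characteristic zero has a non-root. The action is not polynomial in g because of the inverse.
    The adjugate replaces it at the price of a factor det(g)^2, which is harmless because
    multiplying a structure by a nonzero scalar is the action of a homothety. The bound on chains
    needs no theory of transcendence degree: 16 independent functions on a set dominated by affine
    15-space are excluded by counting monomials. For the closure of L2 the 15 parameters come from
    products of the form x y = xi(y) R x, with 3 for xi and 12 for R. The lower bound is proved on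
    one component only, the closure of M14: there the 15 parameters are switched on one at a time,
    and an explicit test function separates each stratum from the next. Algebraic closedness enters
    through a square root in the normalization of T12. *)

Section PolynomialFunctions.
Variable F : fieldType.
Implicit Types I J : Type.

Lemma eq_polyfun I (f g : (I -> F) -> F) : f =1 g -> polyfun f -> polyfun g.
Proof. by move=> fg hf; have <- : f = g by apply: funext. Qed.

Lemma polyfun_opp I (f : (I -> F) -> F) : polyfun f -> polyfun (fun x => - f x).
Proof. by move=> hf; apply: eq_polyfun (pf_mul (pf_const _ (-1)) hf) => x; rewrite mulN1r. Qed.

Lemma polyfun_sub I (f g : (I -> F) -> F) :
  polyfun f -> polyfun g -> polyfun (fun x => f x - g x).
Proof. by move=> hf hg; apply: pf_add => //; apply: polyfun_opp. Qed.

Lemma polyfun_sum I (K : Type) (r : seq K) (f : K -> (I -> F) -> F) :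
  (forall i, polyfun (f i)) -> polyfun (fun x => \sum_(i <- r) f i x).
Proof.
move=> hf; elim: r => [|i r IH].
  by apply: eq_polyfun (pf_const _ 0) => x; rewrite big_nil.
by apply: eq_polyfun (pf_add (hf i) IH) => x; rewrite big_cons.
Qed.

Lemma polyfun_prod I (K : Type) (r : seq K) (f : K -> (I -> F) -> F) :
  (forall i, polyfun (f i)) -> polyfun (fun x => \prod_(i <- r) f i x).
Proof.
move=> hf; elim: r => [|i r IH].
  by apply: eq_polyfun (pf_const _ 1) => x; rewrite big_nil.
by apply: eq_polyfun (pf_mul (hf i) IH) => x; rewrite big_cons.
Qed.

Lemma polyfun_exp I (f : (I -> F) -> F) n : polyfun f -> polyfun (fun x => f x ^+ n).
Proof.
move=> hf; elim: n => [|n IH]; first by apply: pf_const.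
by apply: eq_polyfun (pf_mul hf IH) => x; rewrite exprS.
Qed.

Definition polymap I J (phi : (J -> F) -> (I -> F)) :=
  forall i, polyfun (fun y => phi y i).

Lemma polyfun_comp I J (f : (I -> F) -> F) (phi : (J -> F) -> (I -> F)) :
  polyfun f -> polymap phi -> polyfun (fun y => f (phi y)).
Proof.
move=> hf hphi; elim: hf => [c|i|g h _ IHg _ IHh|g h _ IHg _ IHh].
- exact: pf_const.
- exact: hphi.
- exact: pf_add.
- exact: pf_mul.
Qed.

(** Restriction to a line turns statements about arbitrarily many variables into root counting for
    one-variable polynomials. *)
Lemma polyfun_line I (f : (I -> F) -> F) (x y : I -> F) : polyfun f ->
  exists p : {poly F}, forall t, p.[t] = f (fun i => x i + t * (y i - x i)).
Proof.
elim=> [c|i|g h _ [p Hp] _ [q Hq]|g h _ [p Hp] _ [q Hq]].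
- by exists c%:P => t; rewrite hornerC.
- exists ((x i)%:P + 'X * (y i - x i)%:P) => t.
  by rewrite hornerD hornerM hornerX !hornerC.
- by exists (p + q) => t; rewrite hornerD Hp Hq.
- by exists (p * q) => t; rewrite hornerM Hp Hq.
Qed.

(** The zeros of a single polynomial function form a closed set, so membership in a closure can be
    tested one function at a time. *)
Lemma zclosureP I (A : (I -> F) -> Prop) x :
  zclosure A x <-> forall f, polyfun f -> (forall a, A a -> f a = 0) -> f x = 0.
Proof.
split=> [Ax f hf fA|H S [P [hP SP]] AS].
  have : zclosed (fun y => f y = 0).
    exists (fun g => g = f); split; first by move=> g ->.
    by move=> y; split => [fy g ->|]; last apply.
  by move/Ax; apply.
by apply/SP => f Pf; apply: H; [exact: hP|move=> a /AS /SP; apply].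
Qed.

Lemma sub_zclosure I (A : (I -> F) -> Prop) : subset_of A (zclosure A).
Proof. by move=> x Ax S _; apply. Qed.

Lemma zclosed_zclosure I (A : (I -> F) -> Prop) : zclosed (zclosure A).
Proof.
exists (fun f => polyfun f /\ (forall a, A a -> f a = 0)); split; first by move=> f [].
move=> x; rewrite zclosureP; split => [H f []|H f hf fA]; first exact: H.
exact: H.
Qed.

Lemma zclosure_min I (A S : (I -> F) -> Prop) :
  zclosed S -> subset_of A S -> subset_of (zclosure A) S.
Proof. by move=> hS AS x; apply. Qed.

Lemma zclosed_family I (K : Type) (f : K -> (I -> F) -> F) :
  (forall k, polyfun (f k)) -> zclosed (fun x => forall k, f k x = 0).
Proof.
move=> hf; exists (fun g => exists k, g = f k); split; first by move=> g [k ->].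
move=> x; split => [H g [k ->] //|H k]; apply: H; by exists k.
Qed.

Lemma zclosedI I (A B : (I -> F) -> Prop) :
  zclosed A -> zclosed B -> zclosed (fun x => A x /\ B x).
Proof.
move=> [P [hP AP]] [Q [hQ BQ]]; exists (fun f => P f \/ Q f); split.
  by move=> f [/hP|/hQ].
move=> x; split.
  by move=> [/AP Ax /BQ Bx] f [/Ax|/Bx].
by move=> H; split; [apply/AP|apply/BQ] => f Hf; apply: H; [left|right].
Qed.

End PolynomialFunctions.

Section InfiniteField.
Variable F : numFieldType.
Implicit Types I J : Type.

(** Multiplying [p] by the factors X - a for a in [r] keeps it nonzero, and it cannot vanish at as
    many distinct natural numbers as its size; these are distinct in [F] by characteristic zero. *)
Lemma poly_nonroot_notin (p : {poly F}) (r : seq F) :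
  p != 0 -> exists2 t, p.[t] != 0 & t \notin r.
Proof.
move=> p0; pose q := p * \prod_(a <- r) ('X - a%:P).
have q0 : q != 0 by rewrite mulf_neq0 // monic_neq0 // monic_prod_XsubC.
pose s := [seq i%:R : F | i <- iota 0 (size q)].
have us : uniq s by rewrite map_inj_uniq ?iota_uniq //; exact: mulrIn (oner_neq0 F).
have : ~~ all (root q) s.
  apply/negP => hs; have := max_poly_roots q0 hs us.
  by rewrite size_map size_iota ltnn.
case/allPn => t _; rewrite rootE hornerM mulf_eq0 negb_or => /andP[pt rt]; exists t => //.
by apply: contra rt => tr; rewrite -rootE root_prod_XsubC.
Qed.

(** Affine space is irreducible: on the line from [x] to [y], [f] is nonzero at parameter 0 and [g]
    at parameter 1, so the product of the two restrictions is a nonzero polynomial. *)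
Lemma polyfun_common_nonzero I (f g : (I -> F) -> F) x y : polyfun f -> polyfun g ->
  f x != 0 -> g y != 0 -> exists z, f z != 0 /\ g z != 0.
Proof.
move=> hf hg fx gy.
have [p Hp] := polyfun_line x y hf; have [q Hq] := polyfun_line x y hg.
have p0 : p != 0.
  apply: contra_neq fx => p0; have := Hp 0; rewrite p0 horner0 => ->; congr f.
  by apply: funext => i; rewrite mul0r addr0.
have q0 : q != 0.
  apply: contra_neq gy => q0; have := Hq 1; rewrite q0 horner0 => ->; congr g.
  by apply: funext => i; rewrite mul1r addrC subrK.
have [t] := poly_nonroot_notin [::] (mulf_neq0 p0 q0).
rewrite hornerM mulf_eq0 negb_or Hp Hq => /andP[h1 h2] _.
by exists (fun i => x i + t * (y i - x i)).
Qed.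

Lemma polyfun_eq0_dense I (f h : (I -> F) -> F) y0 : polyfun f -> polyfun h ->
  h y0 != 0 -> (forall y, h y != 0 -> f y = 0) -> forall y, f y = 0.
Proof.
move=> hf hh h0 H y; apply/eqP; apply: contraT => fy.
by have [z [/eqP + /H]] := polyfun_common_nonzero hf hh fy h0.
Qed.

(** If the image lay in neither closed set, one equation of each would pull back to a nonzero
    polynomial. These two and [h] are nonzero at a common parameter, whose image escapes both
    sets. *)
Lemma zirreducible_image I J (phi : (J -> F) -> (I -> F)) (h : (J -> F) -> F) y0 :
  polymap phi -> polyfun h -> h y0 != 0 ->
  zirreducible (zclosure (fun x => exists2 y, h y != 0 & x = phi y)).
Proof.
move=> hphi hh h0; set A := fun x => _; split; first exact: zclosed_zclosure.
split; first by exists (phi y0); apply: sub_zclosure; exists y0.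
move=> S1 S2 [P1 [hP1 SP1]] [P2 [hP2 SP2]] cover.
have [|/asboolPn] := asboolP (subset_of (zclosure A) S1); first by left.
move=> H1; right; have sub2 : subset_of A S2; last first.
  by apply: zclosure_min => //; exists P2.
have [f [Pf [y1 hy1 fy1]]] :
    exists f, P1 f /\ exists2 y, h y != 0 & f (phi y) != 0.
  apply: contrapT => H; move/asboolPn: H1; apply; apply: zclosure_min; first by exists P1.
  move=> _ [y hy ->]; apply/SP1 => f Pf; apply/eqP; apply: contraT => fy.
  by case: H; exists f; split => //; exists y.
move=> _ [y hy ->]; apply/SP2 => g Pg; apply/eqP; apply: contraT => gy.
have pf1 := polyfun_comp (hP1 _ Pf) hphi; have pg1 := polyfun_comp (hP2 _ Pg) hphi.
have [z [fz gz]] := polyfun_common_nonzero pf1 pg1 fy1 gy.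
have [w [/= fgw hw]] := polyfun_common_nonzero (pf_mul pf1 pg1) hh
  (mulf_neq0 fz gz) h0.
have Aw : A (phi w) by exists w.
move: fgw; case: (cover _ (sub_zclosure Aw)) => [/SP1 /(_ _ Pf) ->|/SP2 /(_ _ Pg) ->].
  by rewrite mul0r eqxx.
by rewrite mulr0 eqxx.
Qed.

Lemma zirreducible_zclosure_eq I (A B : (I -> F) -> Prop) :
  (forall x, A x <-> B x) -> zirreducible (zclosure A) -> zirreducible (zclosure B).
Proof. by move=> AB; have -> : A = B by apply: funext => x; apply/propext. Qed.

End InfiniteField.

(** * Dimension of a polynomial image *)

Section ExponentBoxes.

Fixpoint exp_box (d s : nat) : seq (seq nat) :=
  if d is d'.+1 then [seq i :: e | i <- index_iota 0 s, e <- exp_box d' s] else [:: [::]].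

Lemma size_exp_box d s : size (exp_box d s) = (s ^ d)%N.
Proof. by elim: d => //= d IH; rewrite size_allpairs size_iota subn0 IH expnS. Qed.

Lemma exp_box_uniq d s : uniq (exp_box d s).
Proof.
elim: d => //= d IH; apply: allpairs_uniq => //; first exact: iota_uniq.
by move=> [i e] [i' e'] _ _ /= [-> ->].
Qed.

Lemma exp_box_bound d s e : e \in exp_box d s -> all (fun i => i < s)%N e.
Proof.
elim: d e => [|d IH] e /=; first by rewrite inE => /eqP ->.
case/allpairsP => -[i e'] /= [+ /IH He' ->] /=.
by rewrite mem_index_iota He' andbT.
Qed.

End ExponentBoxes.

Section AlgebraicIndependence.
Variables (F : numFieldType) (I : Type).
Implicit Types (fs : seq ((I -> F) -> F)) (Z Y : (I -> F) -> Prop).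

Definition monom fs (e : seq nat) (x : I -> F) : F := \prod_(p <- zip fs e) p.1 x ^+ p.2.

(** Every polynomial relation fits into some box of exponents, so quantifying over boxes expresses
    algebraic independence of the restrictions to [Z] without a ring of polynomials. *)
Definition alg_indep fs Z := forall s (c : seq nat -> F),
  (forall x, Z x -> \sum_(e <- exp_box (size fs) s) c e * monom fs e x = 0) ->
  forall e, e \in exp_box (size fs) s -> c e = 0.

Fixpoint all_polyfun fs := if fs is f :: r then polyfun f /\ all_polyfun r else True.

Lemma polyfun_monom fs e : all_polyfun fs -> polyfun (monom fs e).
Proof.
elim: fs e => [|f fs IH] [|i e] /=.
1-3: by move=> _; apply: eq_polyfun (pf_const _ 1) => x; rewrite /monom big_nil.
move=> [hf hfs]; apply: eq_polyfun (pf_mul (polyfun_exp i hf) (IH e hfs)) => x.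
by rewrite /monom big_cons.
Qed.

Lemma polyfun_combination fs s (c : seq nat -> F) : all_polyfun fs ->
  polyfun (fun x => \sum_(e <- exp_box (size fs) s) c e * monom fs e x).
Proof.
move=> hfs; apply: polyfun_sum => e; apply: pf_mul; first exact: pf_const.
exact: polyfun_monom.
Qed.

(** The vanishing ideal of an irreducible closed set is prime; this is what allows a factor [g] to
    be cancelled. *)
Lemma zirreducible_prime Z (f g : (I -> F) -> F) x0 : zirreducible Z ->
  polyfun f -> polyfun g -> Z x0 -> g x0 != 0 ->
  (forall x, Z x -> g x * f x = 0) -> forall x, Z x -> f x = 0.
Proof.
move=> [_ [_ irr]] hf hg Zx0 gx0 H.
have cl (h : (I -> F) -> F) : polyfun h -> zclosed (fun x => forall _ : unit, h x = 0).
  by move=> hh; apply: (@zclosed_family F I unit (fun _ => h)).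
case: (irr _ _ (cl _ hg) (cl _ hf)).
- by move=> x /H /eqP; rewrite mulf_eq0 => /orP[]/eqP ?; [left|right].
- by move/(_ x0 Zx0 tt) => g0; rewrite g0 eqxx in gx0.
- by move=> h x /h /(_ tt).
Qed.

(** Order a relation by powers of [g]. On [Z] only the constant term survives, and independence on
    [Z] kills its coefficients. The rest is divisible by [g], which is cancelled on the irreducible
    [Z'], and the degree in [g] has dropped. *)
Lemma alg_indep_cons fs Z Z' g x0 : zirreducible Z' -> subset_of Z Z' ->
  all_polyfun fs -> polyfun g -> (forall x, Z x -> g x = 0) -> Z' x0 -> g x0 != 0 ->
  alg_indep fs Z -> alg_indep (g :: fs) Z'.
Proof.
move=> irr ZZ' hfs hg gZ Zx0 gx0 ind s c.
(* The family [b] is arbitrary because cancelling one power of [g] shifts the coefficients by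
   one. *)
have strip n (b : nat -> seq nat -> F) :
  (forall x, Z' x -> \sum_(i < n) g x ^+ i *
     (\sum_(e <- exp_box (size fs) s) b i e * monom fs e x) = 0) ->
  forall i e, (i < n)%N -> e \in exp_box (size fs) s -> b i e = 0.
  elim: n b => [//|n IH] b H.
  have b0 e : e \in exp_box (size fs) s -> b 0%N e = 0.
    apply: ind => x Zx; have := H x (ZZ' x Zx).
    rewrite big_ord_recl expr0 mul1r [X in _ + X]big1 ?addr0 // => i _.
    by rewrite gZ // exprS !mul0r.
  move=> [|i] e; first by move=> _; exact: b0.
  rewrite ltnS => ltin he; apply: (IH (fun j => b j.+1)) => //.
  apply: (zirreducible_prime (x0 := x0) irr _ hg) => //.
    apply: polyfun_sum => j; apply: pf_mul; first exact: polyfun_exp.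
    exact: polyfun_combination.
  move=> x Zx; have := H x Zx; rewrite big_ord_recl.
  rewrite [X in _ * X]big_seq big1 => [|e' he']; last by rewrite b0 // mul0r.
  rewrite mulr0 add0r => Ex; rewrite -[RHS]Ex mulr_sumr; apply: eq_bigr => j _.
  by rewrite mulrA -exprS.
rewrite /= => H e /allpairsP[[i e'] /= [+ he' ->]]; rewrite mem_index_iota => /andP[_ lis].
apply: (strip s (fun i e => c (i :: e))) => // x Zx; rewrite -[RHS](H x Zx).
rewrite big_allpairs_dep big_mkord; apply: eq_bigr => j _.
rewrite mulr_sumr; apply: eq_bigr => e1 _.
by rewrite {2}/monom /= big_cons /= -/(monom fs e1 x) mulrCA.
Qed.

Lemma zchain_alg_indep Y d : zchain Y d ->
  exists fs, [/\ size fs = d, all_polyfun fs & alg_indep fs Y].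
Proof.
move=> [Z [irr [str sub]]].
have [fs [sz pf ind]] :
    exists fs, [/\ size fs = d, all_polyfun fs & alg_indep fs (Z d)].
  suff: forall k, (k <= d)%N -> exists fs, [/\ size fs = k, all_polyfun fs & alg_indep fs (Z k)].
    by apply.
  elim=> [_|k IH ltk].
    (* The empty family is independent because [Z 0] has a point, where a constant relation is
       evaluated. *)
    exists [::]; split=> // s c H e; rewrite /= inE => /eqP ->.
    have [_ [[x Zx] _]] := irr 0%N isT.
    by have := H x Zx; rewrite /= big_seq1 /monom big_nil mulr1.
  have [fs [sz pf ind]] := IH (ltnW ltk); have [ss neq] := str k ltk.
  have [[P [hP ZP]] _] := irr k (ltnW ltk).
  have [g [Pg [x Zx gx]]] : exists g, P g /\ exists2 x, Z k.+1 x & g x != 0.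
    apply: contrapT => H; apply: neq; apply: funext => x; apply: propext; split; first exact: ss.
    move=> Zx; apply/ZP => f Pf; apply/eqP; apply: contraT => fx; case: H.
    by exists f; split => //; exists x.
  exists (g :: fs); split; [by rewrite /= sz|by split => //; apply: hP|].
  apply: (alg_indep_cons (irr _ ltk) ss pf (hP _ Pg) _ Zx gx ind).
  by move=> y /ZP; apply.
exists fs; split => // s c H; apply: ind => x /sub; exact: H.
Qed.

End AlgebraicIndependence.

Section MonomialCount.
Variables (F : numFieldType) (J : finType).
Implicit Types f g : (J -> F) -> F.

(** Bounding the degree in each variable separately makes the monomials a finite function type, with
    (D + 1)^#|J| elements. *)
Definition exp_span (D : nat) f :=
  exists c : {ffun J -> 'I_D.+1} -> F,
    forall x, f x = \sum_(a : {ffun J -> 'I_D.+1}) c a * \prod_j x j ^+ a j.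

Lemma exp_span_ext D f g : f =1 g -> exp_span D f -> exp_span D g.
Proof. by move=> fg [c H]; exists c => x; rewrite -fg. Qed.

Lemma exp_spanD D f g : exp_span D f -> exp_span D g -> exp_span D (fun x => f x + g x).
Proof.
move=> [c Hc] [b Hb]; exists (fun a => c a + b a) => x; rewrite Hc Hb -big_split.
by apply: eq_bigr => a _; rewrite mulrDl.
Qed.

Lemma exp_spanZ D k f : exp_span D f -> exp_span D (fun x => k * f x).
Proof.
move=> [c Hc]; exists (fun a => k * c a) => x; rewrite Hc mulr_sumr.
by apply: eq_bigr => a _; rewrite mulrA.
Qed.

Lemma exp_span_monomial D (a : J -> nat) :
  (forall j, a j <= D)%N -> exp_span D (fun x => \prod_j x j ^+ a j).
Proof.
move=> ha; pose a' : {ffun J -> 'I_D.+1} := [ffun j => inord (a j)].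
exists (fun b => (b == a')%:R) => x; rewrite (bigD1 a') //= eqxx mul1r [X in _ + X]big1 => [|b /negbTE bF].
  by rewrite addr0; apply: eq_bigr => j _; rewrite ffunE inordK // ltnS.
by rewrite bF mul0r.
Qed.

Lemma exp_span_sum D (K : Type) (r : seq K) (f : K -> (J -> F) -> F) :
  (forall i, exp_span D (f i)) -> exp_span D (fun x => \sum_(i <- r) f i x).
Proof.
move=> hf; elim: r => [|i r IH].
  by exists (fun _ => 0) => x; rewrite big_nil big1 // => a _; rewrite mul0r.
by apply: exp_span_ext (exp_spanD (hf i) IH) => x; rewrite big_cons.
Qed.

Lemma exp_spanM D1 D2 f g :
  exp_span D1 f -> exp_span D2 g -> exp_span (D1 + D2) (fun x => f x * g x).
Proof.
move=> [c Hc] [b Hb].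
have: exp_span (D1 + D2) (fun x =>
    \sum_(a : {ffun J -> 'I_D1.+1}) c a * \sum_(a' : {ffun J -> 'I_D2.+1})
       b a' * \prod_j x j ^+ (a j + a' j)).
  apply: exp_span_sum => a; apply: exp_spanZ; apply: exp_span_sum => a'; apply: exp_spanZ.
  by apply: exp_span_monomial => j; rewrite leq_add // -ltnS.
apply: exp_span_ext => x; rewrite Hc Hb mulr_suml; apply: eq_bigr => a _.
rewrite -mulrA; congr (_ * _); rewrite mulr_sumr; apply: eq_bigr => a' _.
rewrite mulrCA; congr (_ * _); rewrite -big_split; apply: eq_bigr => j _.
by rewrite exprD.
Qed.

Lemma exp_span_const D c : exp_span D (fun _ => c).
Proof.
apply: exp_span_ext (exp_spanZ c (@exp_span_monomial D (fun _ => 0%N) _)) => // x.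
by rewrite big1 ?mulr1.
Qed.

Lemma exp_span_leq D E f : (D <= E)%N -> exp_span D f -> exp_span E f.
Proof.
move=> /subnKC <- hf; apply: exp_span_ext (exp_spanM hf (exp_span_const (E - D) 1)) => x.
by rewrite mulr1.
Qed.

Lemma polyfun_exp_span f : polyfun f -> exists D, exp_span D f.
Proof.
elim=> [c|j|{}f g _ [D1 h1] _ [D2 h2]|{}f g _ [D1 h1] _ [D2 h2]].
- by exists 0%N; apply: exp_span_const.
- exists 1%N; have hj i : ((i == j) <= 1)%N by case: eqP.
  apply: exp_span_ext (exp_span_monomial hj) => x.
  rewrite (bigD1 j) //= eqxx expr1 big1 ?mulr1 // => i /negbTE iF.
  by rewrite iF expr0.
- exists (maxn D1 D2); apply: exp_spanD.
    by apply: exp_span_leq h1; rewrite leq_maxl.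
  by apply: exp_span_leq h2; rewrite leq_maxr.
- by exists (D1 + D2)%N; apply: exp_spanM.
Qed.

Lemma exp_spanX D n f : exp_span D f -> exp_span (n * D) (fun x => f x ^+ n).
Proof.
move=> hf; elim: n => [|n IH]; first by apply: exp_span_const.
by apply: exp_span_ext (exp_spanM hf IH) => x; rewrite exprS.
Qed.

(* The [s ^ d] monomials in [d > #|J|] polynomials with exponents below [s] lie in a space of
   dimension [O(s ^ #|J|)], so for large [s] they satisfy a linear relation. *)
Lemma alg_indep_image (I : Type) (phi : (J -> F) -> (I -> F)) (Y : (I -> F) -> Prop) fs :
  polymap phi -> subset_of Y (zclosure (fun x => exists y, x = phi y)) ->
  all_polyfun fs -> alg_indep fs Y -> (size fs <= #|J|)%N.
Proof.
move=> hphi sub hfs ind; rewrite leqNgt; apply/negP => ltd.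
set d := size fs in ltd *; set m := #|J| in ltd *.
(* One [D] serves all exponents: after pullback, a product of powers at most [i] has degree at most
   i D per factor in each variable. *)
have [D hD] : exists D, forall i e, all (fun k => k <= i)%N e ->
    exp_span (size (zip fs e) * (i * D)) (fun y => monom fs e (phi y)).
  clear ind ltd; elim: {d} fs hfs => [|f fs IH] /=.
    move=> _; exists 0%N => i e _.
    by apply: exp_span_ext (exp_span_const _ 1) => y; case: e => [|? ?]; rewrite /monom big_nil.
  move=> [hf hfs]; have [D hD] := IH hfs.
  have [E hE] := polyfun_exp_span (polyfun_comp hf hphi).
  exists (maxn D E) => i [|k e] /=.
    by move=> _; apply: exp_span_ext (exp_span_const _ 1) => y; rewrite /monom big_nil.
  move=> /andP[lki /hD he].
  apply: (@exp_span_ext _ (fun y => f (phi y) ^+ k * monom fs e (phi y))).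
    by move=> y; rewrite /monom big_cons.
  apply: exp_span_leq (exp_spanM (exp_spanX k hE) he).
  by rewrite mulSn leq_add // leq_mul // ?leq_mul ?leq_maxl ?leq_maxr.
(* This [s] makes the count strict: M + 1 <= s (d D + 1), hence K <= s^m (d D + 1)^m < s^(m+1) <=
   s^d = N, the last step because m < d. *)
pose s := ((d * D).+1 ^ m).+1; pose M := (d * (s * D))%N.
pose N := size (exp_box d s); pose K := #|{ffun J -> 'I_M.+1}|.
have ltKN : (K < N)%N.
  rewrite /K /N size_exp_box card_ffun card_ord.
  apply: (@leq_ltn_trans (s ^ m * (d * D).+1 ^ m)%N).
    rewrite -expnMn -/m; case: (posnP m) => [->|m0]; first by rewrite !expn0.
    by rewrite leq_exp2r // /M mulnCA mulnS -add1n leq_add.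
  apply: (@leq_trans (s ^ m * s)%N); first by rewrite ltn_pmul2l ?expn_gt0.
  by rewrite -expnSr leq_pexp2l.
have spanM e : e \in exp_box d s -> exp_span M (fun y => monom fs e (phi y)).
  move=> he; apply: exp_span_leq (hD s e _).
    by rewrite /M leq_mul2r size_zip geq_minl orbT.
  by apply: sub_all (exp_box_bound he) => i /ltnW.
have /choice[A HA] : forall r : 'I_N, exists c : {ffun J -> 'I_M.+1} -> F, forall y,
    monom fs (nth [::] (exp_box d s) r) (phi y) = \sum_a c a * \prod_j y j ^+ a j.
  by move=> r; apply: spanM; rewrite mem_nth.
(* The rows of [B] are the coefficients of the pulled-back monomials. There are more rows than
   columns, so a nonzero left kernel vector exists and gives the forbidden relation. *)
pose B : 'M[F]_(N, K) := \matrix_(r, k) A r (enum_val k).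
have : kermx B != 0.
  rewrite kermx_eq0 /row_free neq_ltn; apply/orP; left.
  by apply: leq_ltn_trans ltKN; apply: rank_leq_col.
rewrite -nz_row_eq0; set v := nz_row _ => v0.
have vB : v *m B = 0 by apply/sub_kermxP/nz_row_sub.
have [r vr] : exists r, v 0 r != 0.
  apply/existsP; apply: contraR v0; rewrite negb_exists => /forallP H.
  by apply/eqP/rowP => r; rewrite mxE; apply/eqP; have := H r; rewrite negbK.
pose c e := if insub (index e (exp_box d s)) : option 'I_N is Some r then v 0 r else 0.
have cE (r' : 'I_N) : c (nth [::] (exp_box d s) r') = v 0 r'.
  by rewrite /c index_uniq ?exp_box_uniq // valK.
case/negP: vr; apply/eqP; rewrite -cE; apply: (ind s c); last exact: mem_nth.
move=> x /sub /zclosureP H.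
apply: (H (fun x => \sum_(e <- exp_box d s) c e * monom fs e x)); first exact: polyfun_combination.
move=> _ [y ->]; rewrite -/d (big_nth [::]) big_mkord -/N.
transitivity (\sum_(r' < N) \sum_a v 0 r' * A r' a * \prod_j y j ^+ a j).
  apply: eq_bigr => r' _; rewrite cE HA mulr_sumr; apply: eq_bigr => a _.
  by rewrite mulrA.
rewrite exchange_big big1 //= => a _; rewrite -mulr_suml.
have := congr1 (fun w : 'M_(1, K) => w 0 (enum_rank a)) vB; rewrite mxE [RHS]mxE => E.
suff -> : \sum_(r' < N) v 0 r' * A r' a = 0 by rewrite mul0r.
by rewrite -[RHS]E; apply: eq_bigr => r' _; rewrite mxE enum_rankK.
Qed.

Lemma zchain_image_leq (I : Type) (phi : (J -> F) -> (I -> F)) (Y : (I -> F) -> Prop) d :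
  polymap phi -> subset_of Y (zclosure (fun x => exists y, x = phi y)) ->
  zchain Y d -> (d <= #|J|)%N.
Proof.
move=> hphi sub /zchain_alg_indep[fs [<- hfs ind]].
exact: alg_indep_image hphi sub hfs ind.
Qed.

End MonomialCount.

(** * Structures, base change and the mono Leibniz condition *)

Section BilinearStructures.
Variables (F : fieldType) (n : nat).
Implicit Types (mu nu : structure F n) (x y z a : vec F n) (g h : 'M[F]_n).
Local Notation e_ := (@basis_vec F n).

Lemma mulS_suml mu (X : vec F n) (v : 'I_n -> vec F n) y k :
  mulS mu (fun l => \sum_i X i * v i l) y k = \sum_i X i * mulS mu (v i) y k.
Proof.
rewrite /mulS; under [RHS]eq_bigr => i _ do rewrite mulr_sumr.
rewrite [RHS]exchange_big; apply: eq_bigr => i _.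
under [RHS]eq_bigr => j _ do rewrite mulr_sumr.
rewrite exchange_big; apply: eq_bigr => j _.
by rewrite -mulrA mulr_suml; apply: eq_bigr => l _; rewrite !mulrA.
Qed.

Lemma mulS_sumr mu (X : vec F n) (v : 'I_n -> vec F n) y k :
  mulS mu y (fun l => \sum_i X i * v i l) k = \sum_i X i * mulS mu y (v i) k.
Proof.
rewrite /mulS; under [RHS]eq_bigr => i _ do rewrite mulr_sumr.
rewrite [RHS]exchange_big; apply: eq_bigr => i _.
under [RHS]eq_bigr => j _ do rewrite mulr_sumr.
rewrite exchange_big; apply: eq_bigr => j _.
by rewrite mulr_sumr mulr_suml; apply: eq_bigr => l _; rewrite mulrCA !mulrA.
Qed.

Lemma mulS_addl mu x y z : mulS mu (vadd x y) z = vadd (mulS mu x z) (mulS mu y z).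
Proof.
apply: funext => k; rewrite /mulS /vadd -big_split; apply: eq_bigr => i _.
by rewrite -big_split; apply: eq_bigr => j _; rewrite !mulrDl.
Qed.

Lemma mulS_addr mu x y z : mulS mu z (vadd x y) = vadd (mulS mu z x) (mulS mu z y).
Proof.
apply: funext => k; rewrite /mulS /vadd -big_split; apply: eq_bigr => i _.
by rewrite -big_split; apply: eq_bigr => j _; rewrite mulrDr mulrDl.
Qed.

Lemma mulS_scalel mu c x y : mulS mu (vscale c x) y = vscale c (mulS mu x y).
Proof.
apply: funext => k; rewrite /mulS /vscale mulr_sumr; apply: eq_bigr => i _.
by rewrite mulr_sumr; apply: eq_bigr => j _; rewrite !mulrA.
Qed.

Lemma mulS_scaler mu c x y : mulS mu x (vscale c y) = vscale c (mulS mu x y).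
Proof.
apply: funext => k; rewrite /mulS /vscale mulr_sumr; apply: eq_bigr => i _.
by rewrite mulr_sumr; apply: eq_bigr => j _; rewrite !mulrA [x i * c]mulrC.
Qed.

Lemma vscale0 x : vscale 0 x = @vzero F n.
Proof. by apply: funext => k; rewrite /vscale mul0r. Qed.

Lemma vscaler0 c : vscale c (@vzero F n) = @vzero F n.
Proof. by apply: funext => k; rewrite /vscale mulr0. Qed.

Lemma vadd0 x : vadd x (@vzero F n) = x.
Proof. by apply: funext => k; rewrite /vadd addr0. Qed.

Lemma mulS0l mu x : mulS mu (@vzero F n) x = @vzero F n.
Proof. by rewrite -[X in mulS _ X](vscale0 x) mulS_scalel vscale0. Qed.

Lemma mulS0r mu x : mulS mu x (@vzero F n) = @vzero F n.
Proof. by rewrite -[X in mulS _ _ X](vscale0 x) mulS_scaler vscale0. Qed.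

Lemma mulS_basis mu i j k : mulS mu (e_ i) (e_ j) k = mu (i, j, k).
Proof.
rewrite /mulS (bigD1 i) //= [X in _ + X]big1 => [|l /negbTE li].
  rewrite addr0 (bigD1 j) //= [X in _ + X]big1 => [|l /negbTE lj].
    by rewrite /basis_vec !eqxx !mul1r addr0.
  by rewrite /basis_vec lj mulr0 mul0r.
by rewrite big1 // => m _; rewrite /basis_vec li !mul0r.
Qed.

Lemma vec_basis x : x = fun l => \sum_i x i * e_ i l.
Proof.
apply: funext => l; rewrite (bigD1 l) //= big1 /basis_vec; first by rewrite eqxx mulr1 addr0.
by move=> i /negbTE; rewrite eq_sym => ->; rewrite mulr0.
Qed.

Lemma appm1 x : appm 1%:M x = x.
Proof.
apply: funext => k; rewrite /appm (bigD1 k) //= mxE eqxx mul1r big1 ?addr0 // => i /negbTE ik.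
by rewrite mxE eq_sym ik mul0r.
Qed.

Lemma appm_mul g h x : appm g (appm h x) = appm (g *m h) x.
Proof.
apply: funext => k; rewrite /appm; under eq_bigr => l _ do rewrite mulr_sumr.
rewrite exchange_big; apply: eq_bigr => l _; rewrite mxE mulr_suml.
by apply: eq_bigr => i _; rewrite mulrA.
Qed.

Lemma appmK g x : g \in unitmx -> appm (invmx g) (appm g x) = x.
Proof. by move=> ug; rewrite appm_mul mulVmx // appm1. Qed.

Lemma appmVK g x : g \in unitmx -> appm g (appm (invmx g) x) = x.
Proof. by move=> ug; rewrite appm_mul mulmxV // appm1. Qed.

Lemma appm_basis g i k : appm g (e_ i) k = g k i.
Proof.
rewrite /appm (bigD1 i) //= big1 /basis_vec; first by rewrite eqxx mulr1 addr0.
by move=> j /negbTE ->; rewrite mulr0.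
Qed.

Lemma appm_sum g (X : vec F n) (v : 'I_n -> vec F n) k :
  appm g (fun l => \sum_i X i * v i l) k = \sum_i X i * appm g (v i) k.
Proof.
rewrite /appm; under [RHS]eq_bigr => i _ do rewrite mulr_sumr.
rewrite [RHS]exchange_big; apply: eq_bigr => l _; rewrite mulr_sumr.
by apply: eq_bigr => i _; rewrite mulrCA.
Qed.

Lemma appm_vzero g : appm g (@vzero F n) = @vzero F n.
Proof. by apply: funext => k; rewrite /appm big1 // => i _; rewrite mulr0. Qed.

Lemma appm_hom_basis mu nu g :
  (forall i j k, mulS nu (fun l => g l i) (fun l => g l j) k = \sum_l g k l * mu (i, j, l)) ->
  forall x y, appm g (mulS mu x y) = mulS nu (appm g x) (appm g y).
Proof.
move=> H x y; apply: funext => k; rewrite [x in RHS]vec_basis.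
have E z : appm g (fun l => \sum_i z i * e_ i l) = fun l => \sum_i z i * appm g (e_ i) l.
  by apply: funext => l; rewrite appm_sum.
have Ee i : appm g (e_ i) = fun l => g l i by apply: funext => l; rewrite appm_basis.
rewrite E mulS_suml [y in RHS]vec_basis E.
have -> : appm g (mulS mu x y) k =
    \sum_l g k l * \sum_i \sum_j x i * y j * mu (i, j, l) by [].
under [LHS]eq_bigr => l _ do rewrite mulr_sumr.
rewrite exchange_big; apply: eq_bigr => i _; rewrite mulS_sumr mulr_sumr.
under [LHS]eq_bigr => l _ do rewrite mulr_sumr.
rewrite exchange_big; apply: eq_bigr => j _.
rewrite !Ee H !mulr_sumr; apply: eq_bigr => l _; ring.
Qed.

Lemma act_hom mu g x y : g \in unitmx ->
  appm g (mulS mu x y) = mulS (act g mu) (appm g x) (appm g y).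
Proof.
move=> ug; rewrite -{1}(appmK x ug) -{1}(appmK y ug).
set X := appm g x; set Y := appm g y; apply: funext => k.
have E z : appm (invmx g) z = fun l => \sum_i z i * appm (invmx g) (e_ i) l.
  by apply: funext => l; rewrite {1}[z]vec_basis appm_sum.
rewrite [in LHS](E X) [in LHS](E Y) {1}/appm.
under eq_bigr => l _ do rewrite mulS_suml mulr_sumr.
rewrite exchange_big; apply: eq_bigr => i _.
under eq_bigr => l _ do rewrite mulS_sumr !mulr_sumr.
rewrite exchange_big; apply: eq_bigr => j _.
rewrite /act {2}/appm mulr_sumr; apply: eq_bigr => l _.
ring.
Qed.

Lemma act_unique mu nu g : g \in unitmx ->
  (forall i j k, mulS nu (fun l => g l i) (fun l => g l j) k = \sum_l g k l * mu (i, j, l)) ->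
  nu = act g mu.
Proof.
move=> ug /appm_hom_basis H; apply: funext => -[[i j] k].
by rewrite -mulS_basis -{1}(appmVK (e_ i) ug) -{1}(appmVK (e_ j) ug) -H.
Qed.

Lemma hom_act mu nu g : g \in unitmx ->
  (forall x y, appm g (mulS mu x y) = mulS nu (appm g x) (appm g y)) -> nu = act g mu.
Proof.
move=> ug H; apply: funext => -[[i j] k].
by rewrite -mulS_basis -{1}(appmVK (e_ i) ug) -{1}(appmVK (e_ j) ug) -H.
Qed.

Lemma act_comp mu g h : g \in unitmx -> h \in unitmx -> act g (act h mu) = act (g *m h) mu.
Proof.
move=> ug uh; apply: hom_act; first by rewrite unitmx_mul ug.
by move=> x y; rewrite -appm_mul !act_hom // !appm_mul.
Qed.

Lemma act1 mu : act 1%:M mu = mu.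
Proof. by symmetry; apply: hom_act => [|x y]; rewrite ?unitmx1 // !appm1. Qed.

Lemma gl_orbit_refl mu : gl_orbit mu mu.
Proof. by exists 1%:M; rewrite unitmx1 act1. Qed.

Lemma gl_orbit_sym mu nu : gl_orbit mu nu -> gl_orbit nu mu.
Proof.
move=> [g [ug ->]]; exists (invmx g); rewrite unitmx_inv ug act_comp ?unitmx_inv //.
by rewrite mulVmx // act1.
Qed.

Lemma gl_orbit_trans mu nu la : gl_orbit mu nu -> gl_orbit nu la -> gl_orbit mu la.
Proof.
move=> [g [ug ->]] [h [uh ->]]; exists (h *m g).
by rewrite unitmx_mul uh ug act_comp.
Qed.

(** A product is quadratic in its arguments and linear in its value, so a homothety of ratio 1/c
    multiplies the structure by [c]. Orbits are thus stable under nonzero scaling, which absorbs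
    powers of determinants. *)
Lemma act_scale mu g c : c != 0 -> g \in unitmx ->
  act g (fun p => c * mu p) = act (c^-1 *: g) mu.
Proof.
move=> c0 ug; have uc : c^-1 *: g \in unitmx by rewrite unitmxZ // unitfE invr_eq0.
have appZ d z : appm (d *: g) z = vscale d (appm g z).
  apply: funext => k; rewrite /appm /vscale mulr_sumr; apply: eq_bigr => l _.
  by rewrite mxE mulrA.
have mulZ x y : mulS (fun p => c * mu p) x y = vscale c (mulS mu x y).
  apply: funext => k; rewrite /mulS /vscale mulr_sumr; apply: eq_bigr => i _.
  by rewrite mulr_sumr; apply: eq_bigr => j _; rewrite mulrCA.
symmetry; apply: hom_act => // x y.
have -> : appm g (mulS (fun p => c * mu p) x y) = vscale (c * c) (appm (c^-1 *: g) (mulS mu x y)).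
  rewrite appZ mulZ; apply: funext => k; rewrite /vscale mulrA mulfK // /appm mulr_sumr.
  by apply: eq_bigr => l _; rewrite mulrCA.
rewrite act_hom // !appZ mulS_scalel mulS_scaler.
by apply: funext => k; rewrite /vscale; field.
Qed.

(** The index is shifted: [rpow mu a m] has m + 1 factors, so an exponent [j.+1] ranges over the
    powers from the square on. *)
Fixpoint rpow mu a m := if m is m'.+1 then mulS mu (rpow mu a m') a else a.

Lemma rpow_act mu g a m : g \in unitmx -> rpow (act g mu) (appm g a) m = appm g (rpow mu a m).
Proof. by move=> ug; elim: m => //= m ->; rewrite act_hom. Qed.

Inductive rpow_tail mu a : vec F n -> Prop :=
| rt_zero : rpow_tail mu a (@vzero F n)
| rt_pow m : rpow_tail mu a (rpow mu a m.+1)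
| rt_add x y : rpow_tail mu a x -> rpow_tail mu a y -> rpow_tail mu a (vadd x y)
| rt_scale c x : rpow_tail mu a x -> rpow_tail mu a (vscale c x).

(** Forward: for x in the subalgebra, the Leibniz identity at (x, a, a) leaves x(aa) = 0, and at (x,
    a_j, a) it passes from a_j to a_{j+1}. Backward: the generated subalgebra G is F a + W, with W
    spanned by the right powers from the square on. Since G W = 0, x(yz) vanishes and the identity
    reduces to (xy)z = (xz)y. *)
Lemma mono_leibnizP mu :
  mono_leibniz mu <-> forall a i j, mulS mu (rpow mu a i) (rpow mu a j.+1) = @vzero F n.
Proof.
split=> [H a i j|H a].
  have genp m : gen_subalg mu a (rpow mu a m).
    by elim: m => [|m IH] /=; [apply: gs_gen|apply: gs_mul IH (gs_gen _ _)].
  have cancel (u v w : vec F n) : u = vadd v w -> u = v -> w = @vzero F n.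
    move=> -> E; apply: funext => k; have := congr1 (fun f => f k) E.
    by rewrite /vadd => e; rewrite -[LHS](addKr (v k)) e addNr.
  have: forall x, gen_subalg mu a x -> mulS mu x (rpow mu a j.+1) = @vzero F n.
    elim: j => [|j IH] x gx.
      exact: cancel (H a _ _ _ gx (gs_gen _ _) (gs_gen _ _)) erefl.
    apply: cancel (H a _ _ _ gx (genp j.+1) (gs_gen _ _)) _.
    rewrite IH // mulS0l IH //; exact: gs_mul gx (gs_gen _ _).
  by apply.
pose W := rpow_tail mu a.
have pW x : (exists m, x = rpow mu a m) -> forall w, W w -> mulS mu x w = @vzero F n.
  move=> [m ->] w; elim=> [|j|u v _ IHu _ IHv|c u _ IH]; first exact: mulS0r.
  - exact: H.
  - by rewrite mulS_addr IHu IHv vadd0.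
  - by rewrite mulS_scaler IH vscaler0.
have WW x : W x -> forall w, W w -> mulS mu x w = @vzero F n.
  elim=> [|j|u v _ IHu _ IHv|c u _ IH] w Ww; first exact: mulS0l.
  - by apply: pW => //; exists j.+1.
  - by rewrite mulS_addl IHu // IHv // vadd0.
  - by rewrite mulS_scalel IH // vscaler0.
have Wa x : W x -> W (mulS mu x a).
  elim=> [|j|u v _ IHu _ IHv|c u _ IH]; first by rewrite mulS0l; exact: rt_zero.
  - exact: (rt_pow mu a j.+1).
  - by rewrite mulS_addl; apply: rt_add.
  - by rewrite mulS_scalel; apply: rt_scale.
pose G x := exists c w, x = vadd (vscale c a) w /\ W w.
have Gadd x y : G x -> G y -> G (vadd x y).
  move=> [c [w [-> hw]]] [d [v [-> hv]]]; exists (c + d), (vadd w v); split; last exact: rt_add.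
  by apply: funext => k; rewrite /vadd /vscale; ring.
have Gscale d x : G x -> G (vscale d x).
  move=> [c [w [-> hw]]]; exists (d * c), (vscale d w); split; last exact: rt_scale.
  by apply: funext => k; rewrite /vadd /vscale; ring.
have GW x : W x -> G x.
  by move=> hx; exists 0, x; split => //; rewrite vscale0; apply: funext => k; rewrite /vadd add0r.
have Ga x : G x -> W (mulS mu x a).
  move=> [c [w [-> hw]]]; rewrite mulS_addl mulS_scalel; apply: rt_add; last exact: Wa.
  exact/rt_scale/(rt_pow mu a 0).
have Gw x w : G x -> W w -> mulS mu x w = @vzero F n.
  move=> [c [v [-> hv]]] hw; rewrite mulS_addl mulS_scalel (WW v) // vadd0.
  by rewrite pW ?vscaler0 //; exists 0%N.
have Gmul x c w : G x -> W w -> mulS mu x (vadd (vscale c a) w) = vscale c (mulS mu x a).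
  by move=> hx hw; rewrite mulS_addr (Gw x w) // vadd0 mulS_scaler.
have genG x : gen_subalg mu a x -> G x.
  elim=> [||u v _ IHu _ IHv|c u _ IH|u v _ IHu _ [c [w [-> hw]]]].
  - exists 1, (@vzero F n); split; last exact: rt_zero.
    by rewrite vadd0; apply: funext => k; rewrite /vscale mul1r.
  - by apply: GW; apply: rt_zero.
  - exact: Gadd.
  - exact: Gscale.
  - by rewrite Gmul //; apply: Gscale; apply: GW; apply: Ga.
move=> x y z /genG hx /genG hy /genG hz.
have Gz u : G u -> G (mulS mu u a) by move=> /Ga/GW.
(* Right multiplication by an element of G is a scalar multiple of right multiplication by [a], so
   these operators commute on G. *)
have mulG y' : G y' -> exists c, forall u, G u -> mulS mu u y' = vscale c (mulS mu u a).
  by move=> [c [w [-> hw]]]; exists c => u hu; apply: Gmul.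
have [[c Ec] [d Ed]] := (mulG _ hy, mulG _ hz).
have Gxa c' : G (vscale c' (mulS mu x a)) by apply/Gscale/GW/Ga.
rewrite (Gw x (mulS mu y z)) //; last by rewrite Ed //; apply/rt_scale/Ga.
rewrite vadd0 (Ec x) // (Ed x) // (Ec _ (Gxa _)) (Ed _ (Gxa _)) !mulS_scalel.
by apply: funext => k; rewrite /vscale mulrCA.
Qed.

End BilinearStructures.

Section PolynomialStructures.
Variables (F : fieldType) (n : nat) (J : Type).

Lemma polymap_mulS (M : (J -> F) -> structure F n) (x y : (J -> F) -> vec F n) :
  polymap M -> polymap x -> polymap y -> polymap (fun w => mulS (M w) (x w) (y w)).
Proof.
move=> hM hx hy k; apply: polyfun_sum => i; apply: polyfun_sum => j.
by apply: pf_mul; [apply: pf_mul; [apply: hx|apply: hy]|apply: hM].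
Qed.

Lemma polymap_cst (I : Type) (c : I -> F) : polymap (fun _ : J -> F => c).
Proof. by move=> i; apply: pf_const. Qed.

Lemma polymap_rpow (M : (J -> F) -> structure F n) (x : (J -> F) -> vec F n) m :
  polymap M -> polymap x -> polymap (fun w => rpow (M w) (x w) m).
Proof. by move=> hM hx; elim: m => //= m IH; apply: polymap_mulS. Qed.

Lemma polymap_appm (g : (J -> F) -> 'M[F]_n) (x : (J -> F) -> vec F n) :
  (forall i j, polyfun (fun w => g w i j)) -> polymap x -> polymap (fun w => appm (g w) (x w)).
Proof. by move=> hg hx k; apply: polyfun_sum => l; apply: pf_mul. Qed.

End PolynomialStructures.

Lemma polymap_id (F : fieldType) (I : Type) : polymap (fun x : I -> F => x).
Proof. by move=> i; apply: pf_coord. Qed.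

(** * Nilpotency and strict triangularization *)

Section Triangularization.
Variables (F : fieldType) (I : Type).

Definition mxword n (A : I -> 'M[F]_n) (s : seq I) : 'M[F]_n :=
  foldr (fun i (M : 'M[F]_n) => A i *m M) 1%:M s.

Lemma mxword_rcons n (A : I -> 'M[F]_n) s i : mxword A (rcons s i) = mxword A s *m A i.
Proof. by elim: s => [|j s /= ->] /=; rewrite ?mulmx1 ?mul1mx ?mulmxA. Qed.

Lemma mxword_conj n (A : I -> 'M[F]_n) (P Q : 'M[F]_n) s : Q *m P = 1%:M -> P *m Q = 1%:M ->
  mxword (fun i => P *m A i *m Q) s = P *m mxword A s *m Q.
Proof.
move=> QP PQ; elim: s => [|i s /= ->]; first by rewrite /= mulmx1.
by rewrite !mulmxA -(mulmxA (P *m A i)) QP mulmx1.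
Qed.

(** A nonzero word of maximal length has rows that every [A i] kills. The size [n.+1] makes the
    empty word nonzero, so the descent stops. *)
Lemma nilpotent_common_kernel n (A : I -> 'M[F]_n.+1) N :
  (forall s, size s = N -> mxword A s = 0) ->
  exists2 v : 'rV_n.+1, v != 0 & forall i, v *m A i = 0.
Proof.
elim: N => [|N IH] H.
  by have /eqP := H [::] erefl; rewrite /= oner_eq0.
case: (asboolP (forall s, size s = N -> mxword A s = 0)) => [//|nH].
have [s [ss sn0]] : exists s, size s = N /\ mxword A s != 0.
  apply: contrapT => H'; apply: nH => s ss; apply/eqP; apply: contraT => ?.
  by case: H'; exists s.
exists (nz_row (mxword A s)); first by rewrite nz_row_eq0.
move=> i; have /submxP[D ->] := nz_row_sub (mxword A s).
by rewrite -mulmxA -mxword_rcons H ?mulmx0 // size_rcons ss.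
Qed.

(** Engel-type induction: with the common kernel vector as first basis row, all conjugated matrices
    have zero first row, and words in their lower right blocks still vanish. *)
Lemma strict_triangularization n (A : I -> 'M[F]_n) N :
  (forall s, size s = N -> mxword A s = 0) ->
  exists P Q, [/\ P *m Q = 1%:M, Q *m P = 1%:M &
    forall i (r c : 'I_n), (r <= c)%N -> (P *m A i *m Q) r c = 0].
Proof.
elim: n A => [|n IH] A H.
  exists 1%:M, 1%:M; split; rewrite ?mulmx1 // => i; by case.
have [v v0 vA] := nilpotent_common_kernel H.
pose P0 := row_ebase v : 'M_(1 + n); pose Q0 := invmx P0.
have PQ0 : P0 *m Q0 = 1%:M by rewrite mulmxV // row_ebase_unit.
have QP0 : Q0 *m P0 = 1%:M by rewrite mulVmx // row_ebase_unit.
pose B i := P0 *m A i *m Q0 : 'M_(1 + n).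
have B0 i : usubmx (B i) = 0.
  have rv : \rank v = 1%N by rewrite rank_rV v0.
  (* Up to the invertible 1 by 1 matrix [col_ebase v], the first row of [row_ebase v] is [v]. *)
  have : (pid_mx (\rank v) : 'M_(1, n.+1)) *m row_ebase v *m A i = 0.
    apply: (can_inj (mulKmx (col_ebase_unit v))).
    by rewrite mulmx0 !mulmxA mulmx_ebase vA.
  rewrite rv => E; rewrite /B -mulmxA -[P0]vsubmxK mul_col_mx col_mxKu mulmxA.
  suff -> : usubmx P0 *m A i = 0 by rewrite mul0mx.
  rewrite -[RHS]E; congr (_ *m _); apply/rowP => j; rewrite !mxE (bigD1 ord0) //=.
  rewrite [X in _ + X]big1 => [|l l0].
    by rewrite mxE eqxx mul1r addr0; congr (row_ebase v _ _); apply: val_inj.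
  by move: l0; rewrite -val_eqE /= mxE /= eq_sym => /negbTE ->; rewrite mul0r.
pose C i := drsubmx (B i).
have Bblock i : B i = block_mx 0 0 (dlsubmx (B i)) (C i).
  rewrite -{1}[B i]submxK; congr block_mx.
    by rewrite /ulsubmx B0; apply/matrixP => ? ?; rewrite !mxE.
  by rewrite /ursubmx B0; apply/matrixP => ? ?; rewrite !mxE.
have wordB s : exists D E, mxword B s = block_mx D 0 E (mxword C s).
  elim: s => [|i s [D [E IHs]]] /=; first by exists 1%:M, 0; rewrite -scalar_mx_block.
  rewrite IHs Bblock mulmx_block !mul0mx !mulmx0 !addr0 add0r.
  by eexists; eexists.
have HC s : size s = N -> mxword C s = 0.
  move=> /H Hs; have [D [E]] := wordB s.
  rewrite (mxword_conj A s QP0 PQ0) Hs mulmx0 mul0mx => /(congr1 (@drsubmx F 1 n 1 n)).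
  by rewrite block_mxKdr => <-; apply/matrixP => ? ?; rewrite !mxE.
have [P1 [Q1 [PQ1 QP1 tri]]] := IH C HC.
pose D1 := block_mx 1%:M 0 0 P1 : 'M_(1 + n); pose D2 := block_mx 1%:M 0 0 Q1 : 'M_(1 + n).
have D12 : D1 *m D2 = 1%:M.
  by rewrite mulmx_block !mul0mx !mulmx0 !addr0 !add0r mulmx1 PQ1 -scalar_mx_block.
have D21 : D2 *m D1 = 1%:M.
  by rewrite mulmx_block !mul0mx !mulmx0 !addr0 !add0r mulmx1 QP1 -scalar_mx_block.
exists (D1 *m P0), (Q0 *m D2); split.
- by rewrite mulmxA -(mulmxA D1) PQ0 mulmx1.
- by rewrite mulmxA -(mulmxA Q0) D21 mulmx1.
move=> i; suff H' : forall r c : 'I_(1 + n), (r <= c)%N -> (D1 *m B i *m D2) r c = 0.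
  by move=> r c /H'; rewrite /B !mulmxA.
move=> r c lerc; rewrite Bblock.
rewrite /D1 /D2 !mulmx_block !(mul0mx, mulmx0, addr0, add0r).
have [r' rE|r' rE] := @splitP 1 n r.
  have -> : r = lshift n r' by apply: val_inj.
  have [c' cE|c' cE] := @splitP 1 n c.
    have -> : c = lshift n c' by apply: val_inj.
    by rewrite block_mxEul mxE.
  have -> : c = rshift 1 c' by apply: val_inj.
  by rewrite block_mxEur mxE.
have -> : r = rshift 1 r' by apply: val_inj.
have [c' cE|c' cE] := @splitP 1 n c.
  by move: lerc; rewrite rE cE; case: c' {cE} => -[].
have -> : c = rshift 1 c' by apply: val_inj.
by rewrite block_mxEdr tri //; move: lerc; rewrite rE cE !add1n.
Qed.

Lemma strict_triangular_word n (A : I -> 'M[F]_n) :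
  (forall i (r c : 'I_n), (r <= c)%N -> A i r c = 0) ->
  forall s, (n <= size s)%N -> mxword A s = 0.
Proof.
move=> H s; suff E : forall r c : 'I_n, (r < c + size s)%N -> mxword A s r c = 0.
  move=> ns; apply/matrixP => r c; rewrite E ?mxE //.
  by apply: leq_trans (ltn_ord r) _; apply: leq_trans ns (leq_addl _ _).
elim: s => [|i s IH] r c /=; first by rewrite addn0 mxE => rc; case: eqP rc => // ->; rewrite ltnn.
rewrite addnS ltnS => rc; rewrite mxE big1 // => l _.
case: (leqP r l) => rl; first by rewrite H ?mul0r.
by rewrite IH ?mulr0 //; apply: leq_trans rl rc.
Qed.

End Triangularization.

Section NilpotentStructures.
Variables (F : fieldType) (n : nat).
Implicit Types (mu nu : structure F n) (x y v : vec F n) (s : seq (bool * vec F n)).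

(** The boolean says whether [p.2] multiplies from the left. Words in these one-sided
    multiplications replace arbitrary bracketings. *)
Definition side_mul mu v (p : bool * vec F n) := if p.1 then mulS mu p.2 v else mulS mu v p.2.

Definition mul_word mu v s := foldl (side_mul mu) v s.

Definition side_mx mu p : 'M[F]_n := \matrix_(j, k) side_mul mu (@basis_vec F n j) p k.

Definition rowv v : 'rV[F]_n := \row_k v k.

Lemma rowv_side_mul mu v p : rowv (side_mul mu v p) = rowv v *m side_mx mu p.
Proof.
apply/rowP => k; rewrite !mxE; under eq_bigr => l _ do rewrite !mxE.
by case: p => -[] w; rewrite /side_mul /= {1}[v]vec_basis (mulS_sumr, mulS_suml).
Qed.

Lemma rowv_mul_word mu v s : rowv (mul_word mu v s) = rowv v *m mxword (side_mx mu) s.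
Proof.
elim: s v => [|p s IH] v /=; first by rewrite mulmx1.
by rewrite -/(mul_word _ _ _) IH rowv_side_mul mulmxA.
Qed.

Lemma rowv_basis i : rowv (@basis_vec F n i) = delta_mx 0 i.
Proof. by apply/rowP => k; rewrite !mxE eqxx /basis_vec; case: eqP. Qed.

Lemma mxword_side_mx0 mu s :
  (forall v, mul_word mu v s = @vzero F n) <-> mxword (side_mx mu) s = 0.
Proof.
split=> H => [|v].
  apply/row_matrixP => i; rewrite rowE -rowv_basis -rowv_mul_word H row0.
  by apply/rowP => k; rewrite !mxE.
have := rowv_mul_word mu v s; rewrite H mulmx0 => /rowP E.
by apply: funext => k; have := E k; rewrite !mxE.
Qed.

Lemma prods_mul_word mu v s m : prods mu m v -> prods mu (m + size s) (mul_word mu v s).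
Proof.
elim: s v m => [|[b w] s IH] v m pv /=; first by rewrite addn0.
rewrite addnS -addSn; apply: IH; case: b.
  by rewrite -[m.+1]add1n; apply: pr_mul pv; apply: pr_one.
by rewrite -[m.+1]addn1; apply: pr_mul pv _; apply: pr_one.
Qed.

Lemma nilpotent_triangular mu : nilpotent mu ->
  exists P Q : 'M[F]_n, [/\ P *m Q = 1%:M, Q *m P = 1%:M &
    forall p (r c : 'I_n), (r <= c)%N -> (P *m side_mx mu p *m Q) r c = 0].
Proof.
move=> [N0 [N0_gt0 H]]; case: N0 N0_gt0 H => [//|N] _ H; apply: (@strict_triangularization _ _ _ _ N) => s ss.
apply/mxword_side_mx0 => v; apply: H; rewrite -ss -add1n.
exact/prods_mul_word/pr_one.
Qed.

(** Triangularization brings the length of the words down to the dimension. Conversely, a product of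
    at least 2^(k+1) elements has a factor with at least 2^k, so following the larger factor n times
    exhibits a word of length n. The bounded length makes nilpotency a polynomial condition. *)
Lemma nilpotent_wordP mu :
  nilpotent mu <-> forall v s, size s = n -> mul_word mu v s = @vzero F n.
Proof.
split=> [/nilpotent_triangular[P [Q [PQ QP tri]]] v s ss|H].
  move: v; apply/mxword_side_mx0.
  have := strict_triangular_word tri (eq_leq (esym ss)).
  rewrite mxword_conj // => E.
  have <- : Q *m (P *m mxword (side_mx mu) s *m Q) *m P = mxword (side_mx mu) s.
    by rewrite !mulmxA QP mul1mx -mulmxA QP mulmx1.
  by rewrite E mulmx0 mul0mx.
exists (2 ^ n)%N; split; first by rewrite expn_gt0.
have deep k m v : (2 ^ k <= m)%N -> prods mu m v ->
    exists u s, size s = k /\ v = mul_word mu u s.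
  elim: k m v => [|k IH] m v; first by exists v, [::].
  move=> km pv; elim: pv km => [x|m1 m2 u w pu _ pw _].
    by rewrite expnS; have := expn_gt0 2 k; lia.
  rewrite expnS mul2n -addnn => km.
  have [km1|km1] := leqP (2 ^ k) m1.
    have [x [s [ss ->]]] := IH _ _ km1 pu; exists x, (rcons s (false, w)).
    by rewrite size_rcons ss /mul_word foldl_rcons.
  have km2 : (2 ^ k <= m2)%N by lia.
  have [x [s [ss ->]]] := IH _ _ km2 pw; exists x, (rcons s (true, u)).
  by rewrite size_rcons ss /mul_word foldl_rcons.
by move=> v /(deep n _ _ (leqnn _))[u [s [ss ->]]]; apply: H.
Qed.

(** The triangular matrices act on row vectors and are strictly lower triangular, so [rev_ord]
    reverses the basis. Reading the same structure constant through a left and through a right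
    multiplication bounds k by both i and j. *)
Lemma nilpotent_act mu : nilpotent mu ->
  exists h nu, [/\ h \in unitmx, mu = act h nu &
    forall i j k : 'I_n, (k <= i)%N || (k <= j)%N -> nu (i, j, k) = 0].
Proof.
move=> /nilpotent_triangular[P [Q [PQ QP tri]]].
pose f i : vec F n := fun k => P (rev_ord i) k.
pose h : 'M[F]_n := \matrix_(k, i) f i k.
pose nu : structure F n := fun '(i, j, k) =>
  (P *m side_mx mu (true, f i) *m Q) (rev_ord j) (rev_ord k).
have rowf i : row (rev_ord i) P = rowv (f i) by apply/rowP => k; rewrite !mxE.
have nuE i j k : nu (i, j, k) = (rowv (mulS mu (f i) (f j)) *m Q) 0 (rev_ord k).
  rewrite /nu -[mulS mu _ _]/(side_mul mu (f j) (true, f i)) rowv_side_mul -rowf.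
  by rewrite -!row_mul [RHS]mxE.
have nuE' i j k : nu (i, j, k) = (P *m side_mx mu (false, f j) *m Q) (rev_ord i) (rev_ord k).
  rewrite nuE -[mulS mu _ _]/(side_mul mu (f i) (false, f j)) rowv_side_mul -rowf.
  by rewrite -!row_mul [LHS]mxE.
have rev_leq (i j : 'I_n) : (i <= j)%N -> (rev_ord j <= rev_ord i)%N.
  by move=> ij; rewrite /= leq_sub2l.
have uh : h \in unitmx.
  pose h' : 'M[F]_n := \matrix_(i, k) Q k (rev_ord i).
  suff : h *m h' = 1%:M by case/mulmx1_unit.
  apply/matrixP => k l; rewrite mxE; under eq_bigr => i _ do rewrite !mxE.
  rewrite (reindex_inj rev_ord_inj) /=; have := congr1 (fun M : 'M_n => M l k) QP.
  rewrite !mxE eq_sym => <-; apply: eq_bigr => i _.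
  by rewrite /f rev_ordK mulrC.
exists h, nu; split=> //; last first.
  move=> i j k /orP[] /rev_leq hk; last exact: tri.
  by rewrite nuE'; apply: tri.
apply: act_unique => // i j k.
have -> : (fun l => h l i) = f i by apply: funext => l; rewrite mxE.
have -> : (fun l => h l j) = f j by apply: funext => l; rewrite mxE.
transitivity ((rowv (mulS mu (f i) (f j)) *m Q *m P) 0 k).
  by rewrite -mulmxA QP mulmx1 mxE.
rewrite mxE (reindex_inj rev_ord_inj); apply: eq_bigr => l _.
by rewrite nuE [h k l]mxE mulrC.
Qed.

Lemma mul_word_act mu g v s : g \in unitmx ->
  mul_word (act g mu) (appm g v) [seq (p.1, appm g p.2) | p <- s] = appm g (mul_word mu v s).
Proof.
move=> ug; elim: s v => //= -[[] w] s IH v /=; rewrite /side_mul /= -act_hom //; exact: IH.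
Qed.

End NilpotentStructures.

Section NilpotentMonoLeibniz.
Variables (F : fieldType) (n : nat).

Lemma NilMonoLeibP (mu : structure F n) : NilMonoLeib mu <->
  (forall a i j, mulS mu (rpow mu a i) (rpow mu a j.+1) = @vzero F n) /\
  (forall v s, size s = n -> mul_word mu v s = @vzero F n).
Proof. by rewrite /NilMonoLeib mono_leibnizP nilpotent_wordP. Qed.

Lemma NilMonoLeib_act (mu : structure F n) g :
  g \in unitmx -> NilMonoLeib mu -> NilMonoLeib (act g mu).
Proof.
move=> ug /NilMonoLeibP[H1 H2]; apply/NilMonoLeibP; split.
  by move=> a i j; rewrite -(appmVK a ug) !rpow_act // -act_hom // H1 appm_vzero.
move=> v s ss; rewrite -(appmVK v ug).
have -> : s = [seq (p.1, appm g p.2) | p <- [seq (p.1, appm (invmx g) p.2) | p <- s]].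
  rewrite -map_comp -[LHS]map_id; apply: eq_map => -[b w] /=.
  by rewrite appmVK.
by rewrite mul_word_act // H2 ?appm_vzero // size_map.
Qed.

(** Each instance of the two conditions, at fixed vectors and exponents, is polynomial in [mu];
    [zclosed] accepts the resulting infinite family of equations. *)
Lemma zclosed_NilMonoLeib : zclosed (@NilMonoLeib F n).
Proof.
pose f (p : vec F n * nat * nat * 'I_n) (mu : structure F n) :=
  let: (a, i, j, k) := p in mulS mu (rpow mu a i) (rpow mu a j.+1) k.
pose g (p : vec F n * n.-tuple (bool * vec F n) * 'I_n) (mu : structure F n) :=
  let: (v, s, k) := p in mul_word mu v s k.
have hf p : polyfun (f p).
  case: p => [[[a i] j] k]; apply: polymap_mulS; first exact: polymap_id.
    by apply: polymap_rpow; [exact: polymap_id|exact: polymap_cst].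
  by apply: polymap_rpow; [exact: polymap_id|exact: polymap_cst].
have hg p : polyfun (g p).
  case: p => [[v s] k]; suff : forall (s : seq _) (u : structure F n -> vec F n), polymap u ->
      polymap (fun mu => mul_word mu (u mu) s).
    by move/(_ s (fun _ => v) (@polymap_cst _ _ _ _) k).
  elim=> [|[b w] {}s IH] u hu //=; apply: (IH (fun mu => side_mul mu (u mu) (b, w))).
  have hw : polymap (fun _ : structure F n => w) by exact: polymap_cst.
  have hid : polymap (fun mu : structure F n => mu) by exact: polymap_id.
  rewrite /side_mul /=; case: b; [exact: (polymap_mulS hid hw hu)|exact: (polymap_mulS hid hu hw)].
have := zclosedI (zclosed_family hf) (zclosed_family hg).
suff -> : (fun x => (forall k, f k x = 0) /\ (forall k, g k x = 0)) = @NilMonoLeib F n by [].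
apply: funext => mu; apply: propext; rewrite NilMonoLeibP; split.
  move=> [H1 H2]; split.
    by move=> a i j; apply: funext => k; exact: (H1 (a, i, j, k)).
  move=> v s /eqP ss; apply: funext => k; exact: (H2 (v, Tuple ss, k)).
move=> [H1 H2]; split => [[[[a i] j] k]|[[v s] k]]; rewrite /f /g ?H1 ?H2 ?size_tuple //.
Qed.

End NilpotentMonoLeibniz.

(** * Normal forms in dimension four *)

Definition o0 : 'I_4 := @Ordinal 4 0 isT.
Definition o1 : 'I_4 := @Ordinal 4 1 isT.
Definition o2 : 'I_4 := @Ordinal 4 2 isT.
Definition o3 : 'I_4 := @Ordinal 4 3 isT.

Lemma ord4_ind (P : 'I_4 -> Prop) : P o0 -> P o1 -> P o2 -> P o3 -> forall k, P k.
Proof.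
move=> p0 p1 p2 p3 [[|[|[|[|//]]]] lt];
  [move: p0|move: p1|move: p2|move: p3]; congr P; exact: val_inj.
Qed.

Section DimensionFour.
Variable F : fieldType.
Implicit Types (mu nu : structure F 4) (x y z : vec F 4) (w : nat -> F).

Lemma sum4 (f : 'I_4 -> F) : \sum_i f i = f o0 + f o1 + f o2 + f o3.
Proof.
rewrite !big_ord_recl big_ord0 addr0 !addrA.
by congr (_ + _ + _ + _); congr f; apply: val_inj.
Qed.

Lemma mulS4 mu x y k : mulS mu x y k =
  x o0 * (y o0 * mu (o0, o0, k) + y o1 * mu (o0, o1, k) + y o2 * mu (o0, o2, k) + y o3 * mu (o0, o3, k)) +
  x o1 * (y o0 * mu (o1, o0, k) + y o1 * mu (o1, o1, k) + y o2 * mu (o1, o2, k) + y o3 * mu (o1, o3, k)) +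
  x o2 * (y o0 * mu (o2, o0, k) + y o1 * mu (o2, o1, k) + y o2 * mu (o2, o2, k) + y o3 * mu (o2, o3, k)) +
  x o3 * (y o0 * mu (o3, o0, k) + y o1 * mu (o3, o1, k) + y o2 * mu (o3, o2, k) + y o3 * mu (o3, o3, k)).
Proof. by rewrite /mulS sum4 !sum4 !mulrDr !mulrA. Qed.

Definition v4 (a b c d : F) : vec F 4 := fun k =>
  match nat_of_ord k with 0 => a | 1 => b | 2 => c | _ => d end.

Lemma eq_vec4 x a b c d : x o0 = a -> x o1 = b -> x o2 = c -> x o3 = d -> x = v4 a b c d.
Proof. by move=> *; apply: funext; elim/ord4_ind. Qed.

Definition cols4 (f : 'I_4 -> vec F 4) : 'M[F]_4 := \matrix_(k, i) f i k.

Definition frame (f1 f2 f3 f4 : vec F 4) : 'I_4 -> vec F 4 := fun i =>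
  match nat_of_ord i with 0 => f1 | 1 => f2 | 2 => f3 | _ => f4 end.

Lemma cols4_unit (f g : 'I_4 -> vec F 4) :
  (forall k l, f o0 k * g l o0 + f o1 k * g l o1 + f o2 k * g l o2 + f o3 k * g l o3 = (k == l)%:R) ->
  cols4 f \in unitmx.
Proof.
move=> H; have : cols4 f *m cols4 g = 1%:M.
  by apply/matrixP => k l; rewrite !mxE sum4 !mxE H.
by case/mulmx1_unit.
Qed.

(** The frame is block triangular with diagonal blocks of determinants D, p and r; [g1] to [g4] are
    the columns matched with it in [cols4_unit], found by solving backwards. *)
Lemma frame_block_unit a b c d a' b' c' d' p q r :
  a * b' - b * a' != 0 -> p != 0 -> r != 0 ->
  cols4 (frame (v4 a b c d) (v4 a' b' c' d') (v4 0 0 p q) (v4 0 0 0 r)) \in unitmx.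
Proof.
move=> D0 p0 r0; pose D := a * b' - b * a'.
pose g1 := v4 (b' / D) (- b / D) (- (b' * c - b * c') / D / p)
  ((- (b' * d - b * d') / D + (b' * c - b * c') / D * q / p) / r).
pose g2 := v4 (- a' / D) (a / D) (- (a * c' - a' * c) / D / p)
  ((- (a * d' - a' * d) / D + (a * c' - a' * c) / D * q / p) / r).
pose g3 := v4 0 0 p^-1 (- q / p / r).
pose g4 := v4 0 0 0 r^-1.
apply: (@cols4_unit _ (frame g1 g2 g3 g4)) => k l.
by elim/ord4_ind: k; elim/ord4_ind: l; rewrite /frame /g1 /g2 /g3 /g4 /D /v4 /=;
  field; rewrite ?D0 ?p0 ?r0.
Qed.

Lemma frame_orbit nu mu f : cols4 f \in unitmx ->
  (forall i j k, mulS mu (f i) (f j) k = f o0 k * nu (i, j, o0) + f o1 k * nu (i, j, o1)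
     + f o2 k * nu (i, j, o2) + f o3 k * nu (i, j, o3)) ->
  gl_orbit nu mu.
Proof.
move=> uf H; exists (cols4 f); split=> //; apply: act_unique => // i j k.
have E i' : (fun l => cols4 f l i') = f i' by apply: funext => l; rewrite mxE.
by rewrite !E sum4 !mxE H.
Qed.

(** Only right multiplication by e_1 is nonzero. Parameters are infinite sequences so that [T1] (6
    entries used) and [T14], [T12] (10 each) have the same parameter type. *)
Definition T1 w : structure F 4 := fun '(i, j, k) =>
  match nat_of_ord i, nat_of_ord j, nat_of_ord k with
  | 0, 0, 1 => w 0%N | 0, 0, 2 => w 1%N | 0, 0, 3 => w 2%N
  | 1, 0, 2 => w 3%N | 1, 0, 3 => w 4%N | 2, 0, 3 => w 5%N
  | _, _, _ => 0 end.

Definition T14 w : structure F 4 := fun '(i, j, k) =>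
  match nat_of_ord i, nat_of_ord j, nat_of_ord k with
  | 0, 0, 2 => w 0%N | 0, 0, 3 => w 1%N | 0, 1, 2 => w 2%N | 0, 1, 3 => w 3%N
  | 1, 0, 2 => w 4%N | 1, 0, 3 => w 5%N | 1, 1, 2 => w 6%N | 1, 1, 3 => w 7%N
  | 2, 0, 3 => w 8%N | 2, 1, 3 => w 9%N
  | _, _, _ => 0 end.

Definition T12 w : structure F 4 := fun '(i, j, k) =>
  match nat_of_ord i, nat_of_ord j, nat_of_ord k with
  | 0, 0, 3 => w 0%N | 0, 1, 2 => w 1%N | 1, 0, 2 => - w 1%N | 0, 1, 3 => w 2%N
  | 1, 0, 3 => w 3%N | 1, 1, 3 => w 4%N | 0, 2, 3 => w 5%N | 2, 0, 3 => w 6%N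
  | 1, 2, 3 => w 7%N | 2, 1, 3 => w 8%N | 2, 2, 3 => w 9%N
  | _, _, _ => 0 end.

Lemma mulS_T1 w x y : mulS (T1 w) x y = v4 0 (w 0%N * x o0 * y o0)
  ((w 1%N * x o0 + w 3%N * x o1) * y o0)
  ((w 2%N * x o0 + w 4%N * x o1 + w 5%N * x o2) * y o0).
Proof. by apply: eq_vec4; rewrite mulS4 /=; ring. Qed.

Lemma mulS_T14 w x y : mulS (T14 w) x y = v4 0 0
  (w 0%N * x o0 * y o0 + w 2%N * x o0 * y o1 + w 4%N * x o1 * y o0 + w 6%N * x o1 * y o1)
  (w 1%N * x o0 * y o0 + w 3%N * x o0 * y o1 + w 5%N * x o1 * y o0 + w 7%N * x o1 * y o1 +
   w 8%N * x o2 * y o0 + w 9%N * x o2 * y o1).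
Proof. by apply: eq_vec4; rewrite mulS4 /=; ring. Qed.

Lemma mulS_T12 w x y : mulS (T12 w) x y = v4 0 0
  (w 1%N * (x o0 * y o1 - x o1 * y o0))
  (w 0%N * x o0 * y o0 + w 2%N * x o0 * y o1 + w 3%N * x o1 * y o0 + w 4%N * x o1 * y o1 +
   w 5%N * x o0 * y o2 + w 6%N * x o2 * y o0 + w 7%N * x o1 * y o2 + w 8%N * x o2 * y o1 +
   w 9%N * x o2 * y o2).
Proof. by apply: eq_vec4; rewrite mulS4 /=; ring. Qed.

Definition of_seq (s : seq F) : nat -> F := nth 0 s.

Lemma eq_structure4 mu nu : (forall i j k, mu (i, j, k) = nu (i, j, k)) -> mu = nu.
Proof. by move=> H; apply: funext => -[[i j] k]. Qed.

Lemma L2_T1 : L2 F = T1 (of_seq [:: 1; 0; 0; 1; 0; 1]).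
Proof. by apply: eq_structure4; do 3![elim/ord4_ind]. Qed.

Lemma M12_T12 a : M12 a = T12 (of_seq [:: a; 1; 0; 0; 1; 1; -1; 0; 0; 1]).
Proof. by apply: eq_structure4; do 3![elim/ord4_ind]. Qed.

Lemma M14_T14 a : M14 a = T14 (of_seq [:: 1; 0; 1; 0; 0; 1; a; 0; 0; 1]).
Proof. by apply: eq_structure4; do 3![elim/ord4_ind]. Qed.

(** This is how a goal is deduced from a combination of known equations: [ring] checks that both
    sides differ by the same amount. *)
Lemma eq_by_sub (a b c d : F) : c = d -> a - b = c - d -> a = b.
Proof. by move=> ->; rewrite subrr => /subr0_eq. Qed.

(** The new basis consists of the right powers of e_1 up to the fourth. *)
Lemma T1_orbit w : w 0%N * w 3%N * w 5%N != 0 -> gl_orbit (L2 F) (T1 w).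
Proof.
rewrite !mulf_eq0 !negb_or => /andP[/andP[w0 w3] w5].
pose f := frame (v4 1 0 0 0) (v4 0 (w 0%N) (w 1%N) (w 2%N))
  (v4 0 0 (w 0%N * w 3%N) (w 0%N * w 4%N + w 1%N * w 5%N)) (v4 0 0 0 (w 0%N * w 3%N * w 5%N)).
apply: (@frame_orbit _ _ f).
  by apply: frame_block_unit; rewrite ?mulf_neq0 // mul0r subr0 mul1r.
move=> i j k; rewrite mulS_T1.
by elim/ord4_ind: i; elim/ord4_ind: j; elim/ord4_ind: k; rewrite /f /frame /v4 /=; ring.
Qed.

Definition T14' w := T14 (fun n => if n == 8%N then 0 else w n).

Lemma T14'_orbit w :
  w 9%N * w 0%N * (w 2%N - w 4%N) * (w 5%N * w 0%N - w 4%N * w 1%N) != 0 ->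
  exists a, gl_orbit (M14 a) (T14' w).
Proof.
rewrite !mulf_eq0 !negb_or => /andP[/andP[/andP[s0 b0] D0] G0].
pose s := w 9%N; pose D := w 2%N - w 4%N.
(* Take f1 = u e_1 + z1 e_3, f2 = t e_1 + v e_2 + z2 e_3, f3 = f1 f1 and f4 = f3 f2. The e_3
   coordinates of f2 f1 = f4, f1 f2 = f3 and f2 f2 = a f3 give t, u and a. The e_4 coordinates of
   these equations then give v, z1 and z2. *)
pose v := (w 5%N * w 0%N - w 4%N * w 1%N) / (w 0%N * D * s).
pose u := v * D / w 0%N.
pose t := - v * w 4%N / w 0%N.
pose z1 := (u ^+ 2 * w 1%N - u * v * w 3%N - u * t * w 1%N) / (v * s).
pose a := (v ^+ 2 * w 6%N + v * t * (w 2%N + w 4%N) + t ^+ 2 * w 0%N) / (u ^+ 2 * w 0%N).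
pose z2 := (a * u ^+ 2 * w 1%N - (v ^+ 2 * w 7%N + v * t * (w 3%N + w 5%N) + t ^+ 2 * w 1%N)) / (v * s).
have v0 : v != 0 by rewrite !mulf_neq0 ?invr_neq0 ?mulf_neq0.
have u0 : u != 0 by rewrite !mulf_neq0 ?invr_neq0 ?mulf_neq0.
exists a; pose f := frame (v4 u 0 z1 0) (v4 t v z2 0)
  (v4 0 0 (u ^+ 2 * w 0%N) (u ^+ 2 * w 1%N)) (v4 0 0 0 (u ^+ 2 * w 0%N * v * s)).
have u20 : u ^+ 2 * w 0%N != 0 by rewrite mulf_neq0 ?expf_neq0.
apply: (@frame_orbit _ _ f).
  apply: frame_block_unit; [by rewrite mul0r subr0 mulf_neq0|exact: u20|].
  by apply: mulf_neq0 s0; apply: mulf_neq0 v0.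
have E1 : u * w 0%N = v * D by rewrite /u divfK.
have E2 : t * w 0%N = - v * w 4%N by rewrite /t divfK.
have E3 : z1 * v * s = u ^+ 2 * w 1%N - u * v * w 3%N - u * t * w 1%N.
  by rewrite /z1; field; rewrite v0 s0.
have E4 : a * (u ^+ 2 * w 0%N) = v ^+ 2 * w 6%N + v * t * (w 2%N + w 4%N) + t ^+ 2 * w 0%N.
  by rewrite /a divfK.
have E5 : z2 * v * s = a * u ^+ 2 * w 1%N - (v ^+ 2 * w 7%N + v * t * (w 3%N + w 5%N) + t ^+ 2 * w 1%N).
  by rewrite /z2; field; rewrite v0 s0.
have E6 : v * w 5%N + t * w 1%N = u * w 0%N * v * s.
  by rewrite E1 /t /v /s /D; field; rewrite s0 b0 D0.
clearbody u v t z1 z2 a; move=> i j k; rewrite mulS_T14.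
elim/ord4_ind: i; elim/ord4_ind: j; elim/ord4_ind: k; rewrite /f /frame /v4 /= -/s; try ring.
- have H : u * (t * w 0%N) - u * (u * w 0%N) = u * (- v * w 4%N) - u * (v * D) by rewrite E2 E1.
  by apply: (eq_by_sub H); rewrite /D; ring.
- by apply: (eq_by_sub E3); ring.
- by apply: (eq_by_sub (congr1 ( *%R u) E2)); ring.
- by apply: (eq_by_sub (congr1 ( *%R u) E6)); ring.
- by apply: (eq_by_sub (esym E4)); ring.
- by apply: (eq_by_sub E5); ring.
Qed.

(** Replacing e_1 by e_1 - q e_2 makes e_3 e_1 vanish. *)
Lemma T14_orbit w : w 9%N != 0 -> exists w', gl_orbit (T14' w') (T14 w).
Proof.
move=> s0; pose q := w 8%N / w 9%N.
exists (of_seq [:: w 0%N - q * (w 2%N + w 4%N) + q ^+ 2 * w 6%N;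
  w 1%N - q * (w 3%N + w 5%N) + q ^+ 2 * w 7%N; w 2%N - q * w 6%N; w 3%N - q * w 7%N;
  w 4%N - q * w 6%N; w 5%N - q * w 7%N; w 6%N; w 7%N; 0; w 9%N]).
have Eq : w 9%N * q = w 8%N by rewrite /q mulrC divfK.
clearbody q.
apply: (@frame_orbit _ _ (frame (v4 1 (- q) 0 0) (v4 0 1 0 0) (v4 0 0 1 0) (v4 0 0 0 1))).
  by apply: frame_block_unit; rewrite ?oner_eq0 // mulr1 mulr0 subr0 oner_eq0.
move=> i j k; rewrite mulS_T14.
by elim/ord4_ind: i; elim/ord4_ind: j; elim/ord4_ind: k; rewrite /frame /v4 /= -?Eq; ring.
Qed.

(** Successive normal forms of [T12], reached in the order [T12_2], [T12_3], [T12_4]: first the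
    products of e_1, e_2 with e_3 become skew, then those of e_2 with e_3 vanish, then e_1 e_2
    becomes skew with e_2 e_1. *)
Definition T12_3 w := T12 (fun n => match n with 6 => - w 5%N | 7 => 0 | 8 => 0 | _ => w n end).
Definition T12_2 w := T12 (fun n => match n with 6 => - w 5%N | 8 => - w 7%N | _ => w n end).
Definition T12_4 w :=
  T12 (fun n => match n with 3 => - w 2%N | 6 => - w 5%N | 7 => 0 | 8 => 0 | _ => w n end).

End DimensionFour.

Section Normalization.
Variable F : numClosedFieldType.
Implicit Types w : nat -> F.

Lemma two_neq0 : 2 != 0 :> F. Proof. by rewrite pnatr_eq0. Qed.

Lemma T12_4_orbit w : w 1%N * w 4%N * w 5%N * w 9%N != 0 ->
  exists a, gl_orbit (M12 a) (T12_4 w).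
Proof.
rewrite !mulf_eq0 !negb_or => /andP[/andP[/andP[b0 s0] k0] t0].
(* With f1 = x e_1, f2 = y e_2, f3 = f1 f2 and f4 = f2 f2, the equation f3 f3 = f4 fixes x^2, and f1
   f3 = f4 then fixes y. *)
pose x := sqrtC (w 4%N / (w 1%N ^+ 2 * w 9%N)).
pose y := w 5%N / (w 1%N * w 9%N).
have Ex : x ^+ 2 * (w 1%N ^+ 2 * w 9%N) = w 4%N.
  by rewrite sqrtCK divfK // mulf_neq0 ?expf_neq0.
have Ey : y * (w 1%N * w 9%N) = w 5%N by rewrite divfK // mulf_neq0.
have x0 : x != 0 by rewrite sqrtC_eq0 mulf_neq0 // invr_neq0 // mulf_neq0 ?expf_neq0.
have y0 : y != 0 by rewrite mulf_neq0 ?invr_neq0 ?mulf_neq0.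
pose u := y ^+ 2 * w 4%N.
have u0 : u != 0 by rewrite mulf_neq0 ?expf_neq0.
pose a := x ^+ 2 * w 0%N / u.
have Ea : a * u = x ^+ 2 * w 0%N by rewrite divfK.
clearbody x y a; exists a.
pose f := frame (v4 x 0 0 0) (v4 0 y 0 0) (v4 0 0 (x * y * w 1%N) (x * y * w 2%N)) (v4 0 0 0 u).
apply: (@frame_orbit _ _ _ f).
  apply: frame_block_unit => //; last by rewrite !mulf_neq0.
  by rewrite mul0r subr0 mulf_neq0.
have Eu : x ^+ 2 * y * w 1%N * w 5%N = u by rewrite /u -Ex -Ey; ring.
have Eu' : (x * y * w 1%N) ^+ 2 * w 9%N = u by rewrite /u -Ex; ring.
move=> i j k; rewrite mulS_T12.
elim/ord4_ind: i; elim/ord4_ind: j; elim/ord4_ind: k; rewrite /f /frame /v4 /=; try ring.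
- by apply: (eq_by_sub (esym Ea)); ring.
- by apply: (eq_by_sub Eu); ring.
- by rewrite /u; ring.
- by apply: (eq_by_sub (esym Eu)); ring.
- by apply: (eq_by_sub Eu'); ring.
Qed.

(** Completing the square: e_1 - c e_2 removes the symmetric part of the products of e_1 and e_2. *)
Lemma T12_3_orbit w : w 4%N != 0 -> exists w', gl_orbit (T12_4 w') (T12_3 w).
Proof.
move=> s0; pose c := (w 2%N + w 3%N) / (2 * w 4%N).
have Ec : 2 * (c * w 4%N) = w 2%N + w 3%N by rewrite mulrCA /c divfK // mulf_neq0 ?two_neq0.
clearbody c.
exists (of_seq [:: w 0%N - c * (w 2%N + w 3%N) + c ^+ 2 * w 4%N; w 1%N;
  w 2%N - c * w 4%N; 0; w 4%N; w 5%N; 0; 0; 0; w 9%N]).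
apply: (@frame_orbit _ _ _ (frame (v4 1 (- c) 0 0) (v4 0 1 0 0) (v4 0 0 1 0) (v4 0 0 0 1))).
  by apply: frame_block_unit; rewrite ?oner_eq0 // mulr1 mulr0 subr0 oner_eq0.
move=> i j k; rewrite mulS_T12.
elim/ord4_ind: i; elim/ord4_ind: j; elim/ord4_ind: k; rewrite /frame /v4 /=; try ring.
by apply: (eq_by_sub (esym Ec)); ring.
Qed.

Lemma T12_2_orbit w : w 5%N != 0 -> exists w', gl_orbit (T12_3 w') (T12_2 w).
Proof.
move=> k0; pose c := w 7%N / w 5%N.
have Ec : c * w 5%N = w 7%N by rewrite divfK.
clearbody c.
exists (of_seq [:: w 0%N; w 1%N; w 2%N - c * w 0%N; w 3%N - c * w 0%N;
  w 4%N - c * (w 2%N + w 3%N) + c ^+ 2 * w 0%N; w 5%N; 0; 0; 0; w 9%N]).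
apply: (@frame_orbit _ _ _ (frame (v4 1 0 0 0) (v4 (- c) 1 0 0) (v4 0 0 1 0) (v4 0 0 0 1))).
  by apply: frame_block_unit; rewrite ?oner_eq0 // mulr1 mul0r subr0 oner_eq0.
move=> i j k; rewrite mulS_T12.
by elim/ord4_ind: i; elim/ord4_ind: j; elim/ord4_ind: k; rewrite /frame /v4 /= -?Ec; ring.
Qed.

(** Completing the square in e_3: subtracting multiples of e_3 from e_1 and e_2 makes their products
    with e_3 skew. *)
Lemma T12_orbit w : w 9%N != 0 -> exists w', gl_orbit (T12_2 w') (T12 w).
Proof.
move=> t0; pose x := (w 5%N + w 6%N) / (2 * w 9%N); pose y := (w 7%N + w 8%N) / (2 * w 9%N).
have Ex : w 6%N = 2 * x * w 9%N - w 5%N.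
  by rewrite /x; field.
have Ey : w 8%N = 2 * y * w 9%N - w 7%N.
  by rewrite /y; field.
clearbody x y.
exists (of_seq [:: w 0%N - x * (w 5%N + w 6%N) + x ^+ 2 * w 9%N; w 1%N;
  w 2%N - y * w 5%N - x * w 8%N + x * y * w 9%N; w 3%N - y * w 6%N - x * w 7%N + x * y * w 9%N;
  w 4%N - y * (w 7%N + w 8%N) + y ^+ 2 * w 9%N;
  w 5%N - x * w 9%N; 0; w 7%N - y * w 9%N; 0; w 9%N]).
apply: (@frame_orbit _ _ _ (frame (v4 1 0 (- x) 0) (v4 0 1 (- y) 0) (v4 0 0 1 0) (v4 0 0 0 1))).
  by apply: frame_block_unit; rewrite ?oner_eq0 // mulr1 mul0r subr0 oner_eq0.
move=> i j k; rewrite mulS_T12.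
by elim/ord4_ind: i; elim/ord4_ind: j; elim/ord4_ind: k; rewrite /frame /v4 /= ?Ex ?Ey; ring.
Qed.

End Normalization.

(** * Reduction to the three linear spaces *)

Section Reduction.
Variable F : numFieldType.
Implicit Types (mu nu : structure F 4) (x y z : vec F 4) (w : nat -> F).

Definition strict_tri nu := forall i j k : 'I_4, (k <= i)%N || (k <= j)%N -> nu (i, j, k) = 0.

Lemma mulS_strict_tri nu x y : strict_tri nu -> mulS nu x y = v4 0
  (nu (o0, o0, o1) * x o0 * y o0)
  (nu (o0, o0, o2) * x o0 * y o0 + nu (o0, o1, o2) * x o0 * y o1 + nu (o1, o0, o2) * x o1 * y o0 +
   nu (o1, o1, o2) * x o1 * y o1)
  (nu (o0, o0, o3) * x o0 * y o0 + nu (o0, o1, o3) * x o0 * y o1 + nu (o1, o0, o3) * x o1 * y o0 +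
   nu (o1, o1, o3) * x o1 * y o1 + nu (o0, o2, o3) * x o0 * y o2 + nu (o2, o0, o3) * x o2 * y o0 +
   nu (o1, o2, o3) * x o1 * y o2 + nu (o2, o1, o3) * x o2 * y o1 + nu (o2, o2, o3) * x o2 * y o2).
Proof.
move=> T; apply: eq_vec4; rewrite mulS4.
- by rewrite !T //; ring.
- by rewrite (T o0 o1) ?(T o0 o2) ?(T o0 o3) ?(T o1) ?(T o2) ?(T o3) //; ring.
- rewrite (T o0 o2) ?(T o0 o3) ?(T o1 o2) ?(T o1 o3) ?(T o2) ?(T o3) //; ring.
- rewrite (T o0 o3) ?(T o1 o3) ?(T o2 o3) ?(T o3) //; ring.
Qed.

(** The split is on a2 (does e_1 e_1 involve e_2), then on whether e_3 occurs as a right factor (a2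
    = 0, T14 or T12) or on c3 (a2 nonzero, T14 or T1). *)
Lemma strict_tri_reduction nu : strict_tri nu ->
  (forall x, mulS nu x (mulS nu x x) = @vzero F 4) ->
  (forall x, mulS nu x (mulS nu (mulS nu x x) x) = @vzero F 4) ->
  exists w, [\/ gl_orbit (T1 w) nu, gl_orbit (T14 w) nu | gl_orbit (T12 w) nu].
Proof.
move=> T H1 H2.
set a2 := nu (o0, o0, o1); set a3 := nu (o0, o0, o2); set a4 := nu (o0, o0, o3).
set b3 := nu (o0, o1, o2); set b4 := nu (o0, o1, o3).
set c3 := nu (o1, o0, o2); set c4 := nu (o1, o0, o3).
set d3 := nu (o1, o1, o2); set d4 := nu (o1, o1, o3).
set p := nu (o0, o2, o3); set q := nu (o2, o0, o3).
set r := nu (o1, o2, o3); set s := nu (o2, o1, o3); set t := nu (o2, o2, o3).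
have E3 (x0 x1 : F) : a2 * x0 ^+ 2 * (b3 * x0 + d3 * x1) = 0.
  have := congr1 (fun f => f o2) (H1 (v4 x0 x1 0 0)).
  rewrite !mulS_strict_tri // /vzero /v4 /= => <-; rewrite /a2 /b3 /d3; ring.
have E4 (x0 x1 x2 : F) : x0 * (b4 * (a2 * x0 ^+ 2) + p * (a3 * x0 ^+ 2 + (b3 + c3) * x0 * x1 + d3 * x1 ^+ 2))
    + x1 * (d4 * (a2 * x0 ^+ 2) + r * (a3 * x0 ^+ 2 + (b3 + c3) * x0 * x1 + d3 * x1 ^+ 2))
    + x2 * (s * (a2 * x0 ^+ 2) + t * (a3 * x0 ^+ 2 + (b3 + c3) * x0 * x1 + d3 * x1 ^+ 2)) = 0.
  have := congr1 (fun f => f o3) (H1 (v4 x0 x1 x2 0)).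
  rewrite !mulS_strict_tri // /vzero /v4 /= => <-.
  rewrite /a2 /a3 /b3 /b4 /c3 /d3 /d4 /p /r /s /t; ring.
have E5 (x0 x1 x2 : F) : (p * x0 + r * x1 + t * x2) * (a2 * x0 ^+ 2 * (c3 * x0 + d3 * x1)) = 0.
  have := congr1 (fun f => f o3) (H2 (v4 x0 x1 x2 0)).
  rewrite !mulS_strict_tri // /vzero /v4 /= => <-.
  rewrite /a2 /c3 /d3 /p /r /t; ring.
have half (u : F) : 2 * u = 0 -> u = 0.
  by move/eqP; rewrite mulf_eq0 pnatr_eq0 /= => /eqP.
have cancel (u v : F) : u * v = 0 -> u != 0 -> v = 0.
  by move/eqP; rewrite mulf_eq0 => /orP[/eqP->|/eqP //]; rewrite eqxx.
(* The coefficients of the polynomial identities are extracted by evaluation at small integer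
   points; R7 uses the points (1,1) and (1,-1) and divides by 2. *)
have R1 : a2 * b3 = 0 by rewrite -[RHS](E3 1 0); ring.
have R2 : a2 * d3 = 0.
  by apply: (eq_by_sub (etrans (E3 1 1) (esym R1))); ring.
have R3 : a2 * b4 + p * a3 = 0 by rewrite -[RHS](E4 1 0 0); ring.
have R4 : r * d3 = 0 by rewrite -[RHS](E4 0 1 0); ring.
have R5 : a2 * s + t * a3 = 0.
  by apply: (eq_by_sub (etrans (E4 1 0 1) (esym R3))); ring.
have R6 : t * d3 = 0.
  by apply: (eq_by_sub (etrans (E4 0 1 1) (esym R4))); ring.
have R7 : p * d3 + r * (b3 + c3) = 0.
  have H := congr2 (fun u v => u - 2 * v) (congr2 +%R (E4 1 1 0) (E4 1 (-1) 0)) R3.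
  by apply: half; rewrite /= mulr0 !addr0 subrr in H; rewrite -[RHS]H; ring.
have R8 : a2 * d4 + p * (b3 + c3) + r * a3 = 0.
  have H := congr2 (fun u v => u - v) (E4 1 1 0) (congr2 +%R (congr2 +%R R3 R7) R4).
  by rewrite /= !addr0 subrr in H; rewrite -[RHS]H; ring.
have R9 : t * (b3 + c3) = 0.
  have H := congr2 (fun u v => u - v) (E4 1 1 1) (congr2 +%R (E4 1 1 0) (congr2 +%R R5 R6)).
  by rewrite /= !addr0 subrr in H; rewrite -[RHS]H; ring.
have Ra (x0 x1 x2 : F) : (p * x0 + r * x1 + t * x2) * (x0 ^+ 3 * (a2 * c3)) = 0.
  have H := congr2 (fun u v => u - (p * x0 + r * x1 + t * x2) * x0 ^+ 2 * x1 * v) (E5 x0 x1 x2) R2.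
  by rewrite /= mulr0 subrr in H; rewrite -[RHS]H; ring.
case: (eqVneq a2 0) => [a20|a20].
  case: (boolP [&& p == 0, r == 0 & t == 0]) => [/and3P[/eqP p0 /eqP r0 /eqP t0]|nz].
    exists (of_seq [:: a3; a4; b3; b4; c3; c4; d3; d4; q; s]); constructor 2.
    suff <- : nu = T14 (of_seq [:: a3; a4; b3; b4; c3; c4; d3; d4; q; s]) by apply: gl_orbit_refl.
    by apply: eq_structure4; do 3![elim/ord4_ind]; rewrite /=;
      first [done|by apply: T|exact: a20|exact: p0|exact: r0|exact: t0].
  have [a30 [bc0 d30]] : a3 = 0 /\ b3 + c3 = 0 /\ d3 = 0.
    rewrite a20 !mul0r !add0r in R3 R5 R8.
    case: (eqVneq t 0) => [t0|t0]; last first.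
      by split; [exact: (cancel _ _ R5 t0)|split; [exact: (cancel _ _ R9 t0)|exact: (cancel _ _ R6 t0)]].
    case: (eqVneq p 0) => [p0|p0]; last first.
      have a30 := cancel _ _ R3 p0; rewrite a30 mulr0 addr0 in R8.
      have bc0 := cancel _ _ R8 p0; rewrite bc0 mulr0 addr0 in R7.
      by split=> //; split=> //; exact: (cancel _ _ R7 p0).
    have r0 : r != 0 by move: nz; rewrite p0 t0 eqxx /= andbT.
    rewrite p0 !mul0r !add0r in R7 R8.
    by split; [exact: (cancel _ _ R8 r0)|split; [exact: (cancel _ _ R7 r0)|exact: (cancel _ _ R4 r0)]].
  have c3E : c3 = - b3 by apply/eqP; rewrite -addr_eq0 addrC bc0.
  exists (of_seq [:: a4; b3; b4; c4; d4; p; q; r; s; t]); constructor 3.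
  suff <- : nu = T12 (of_seq [:: a4; b3; b4; c4; d4; p; q; r; s; t]) by apply: gl_orbit_refl.
  by apply: eq_structure4; do 3![elim/ord4_ind]; rewrite /=;
    first [done|by apply: T|exact: a20|exact: a30|exact: d30|exact: c3E].
have b30 := cancel _ _ R1 a20; have d30 := cancel _ _ R2 a20.
case: (eqVneq c3 0) => [c30|c30].
  rewrite b30 c30 addr0 mulr0 addr0 in R8.
  exists (of_seq [:: 1; a4; 0; p; 0; q; 0; t; a2 * c4 + a3 * q; a2 * r + a3 * t]); constructor 2.
  (* The basis is e_1, e_3, then e_1 e_1 without its e_4 part, then e_4: here e_3 takes the role of
     the second generator. *)
  apply: (@frame_orbit _ _ _ (frame (v4 1 0 0 0) (v4 0 0 1 0) (v4 0 a2 a3 0) (v4 0 0 0 1))).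
    apply: (@cols4_unit _ _ (frame (v4 1 0 0 0) (v4 0 (- a3 / a2) a2^-1 0) (v4 0 1 0 0) (v4 0 0 0 1))).
    by move=> k l; elim/ord4_ind: k; elim/ord4_ind: l; rewrite /frame /v4 /=; field.
  move=> i j k; rewrite mulS_strict_tri // -/a2 -/a3 -/a4 -/b3 -/b4 -/c3 -/c4 -/d3 -/d4
    -/p -/q -/r -/s -/t b30 c30 d30.
  elim/ord4_ind: i; elim/ord4_ind: j; elim/ord4_ind: k; rewrite /frame /v4 /=; try ring.
  - by apply: (eq_by_sub R3); ring.
  - by apply: (eq_by_sub R5); ring.
  - have H := congr2 (fun u v => a2 * u + a3 * v) R8 R5.
    by apply: (eq_by_sub H) => /=; ring.
have ac : a2 * c3 != 0 by rewrite mulf_neq0.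
have p0 : p = 0 by apply: (cancel (a2 * c3) p) ac; rewrite -[RHS](Ra 1 0 0); ring.
have r0 : r = 0.
  by apply: (cancel (a2 * c3) r) ac; rewrite -[RHS](Ra 1 1 0) p0; ring.
have t0 : t = 0.
  by apply: (cancel (a2 * c3) t) ac; rewrite -[RHS](Ra 1 0 1) p0; ring.
rewrite p0 r0 t0 !mul0r !addr0 in R3 R5 R8.
have b40 := cancel _ _ R3 a20; have s0 := cancel _ _ R5 a20; have d40 := cancel _ _ R8 a20.
exists (of_seq [:: a2; a3; a4; c3; c4; q]); constructor 1.
suff <- : nu = T1 (of_seq [:: a2; a3; a4; c3; c4; q]) by apply: gl_orbit_refl.
by apply: eq_structure4; do 3![elim/ord4_ind]; rewrite /=;
  first [done|by apply: T|exact: b30|exact: b40|exact: d30|exact: d40|exact: p0|exact: r0|exact: s0|exact: t0].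
Qed.

Lemma NilMonoLeib_reduction mu : NilMonoLeib mu ->
  exists w, [\/ gl_orbit (T1 w) mu, gl_orbit (T14 w) mu | gl_orbit (T12 w) mu].
Proof.
move=> Xmu; have [_ /nilpotent_act[h [nu [uh muE T]]]] := Xmu.
have nuE : nu = act (invmx h) mu by rewrite muE act_comp ?unitmx_inv // mulVmx // act1.
have : NilMonoLeib nu by rewrite nuE; apply: NilMonoLeib_act; rewrite ?unitmx_inv.
move=> [/mono_leibnizP H _].
have [w Hw] := strict_tri_reduction T (fun x => H x 0%N 0%N) (fun x => H x 0%N 1%N).
have nu_mu : gl_orbit nu mu by exists h.
exists w; case: Hw => Hw; [constructor 1|constructor 2|constructor 3];
  exact: gl_orbit_trans Hw nu_mu.
Qed.

(** Every one-sided multiplication raises by one the first coordinate that may be nonzero, so words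
    of length 4 vanish. *)
Lemma NilMonoLeib_strict_tri nu : strict_tri nu ->
  (forall a i j, mulS nu (rpow nu a i) (rpow nu a j.+1) = @vzero F 4) -> NilMonoLeib nu.
Proof.
move=> T H; apply/NilMonoLeibP; split=> // v s ss.
have low m : forall (s : seq (bool * vec F 4)) v, size s = m ->
    forall k : 'I_4, (k < m)%N -> mul_word nu v s k = 0.
  elim: m => [//|m IH] s1 {}v; case/lastP: s1 => [//|s1 [b u]].
  rewrite size_rcons => -[/IH {}IH] k km; rewrite /mul_word -cats1 foldl_cat /=.
  rewrite -/(mul_word nu v s1); set z := mul_word nu v s1.
  have hz (l : 'I_4) : (l < k)%N -> z l = 0 by move=> lk; apply: IH; apply: leq_trans lk _; rewrite -ltnS.
  rewrite /side_mul; case: b => /=; rewrite /mulS big1 // => i _; rewrite big1 // => j _.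
    case: (leqP k j) => kj; first by rewrite T ?mulr0 // kj orbT.
    by rewrite hz // mulr0 mul0r.
  case: (leqP k i) => ki; first by rewrite T ?mulr0 // ki.
  by rewrite hz // !mul0r.
by apply: funext => k; rewrite (low 4%N).
Qed.

Lemma NilMonoLeib_T1 w : NilMonoLeib (T1 w).
Proof.
apply: NilMonoLeib_strict_tri; first by do 3![elim/ord4_ind].
by move=> a i j /=; rewrite !mulS_T1; apply: funext; elim/ord4_ind; rewrite /v4 /vzero /=; ring.
Qed.

Lemma NilMonoLeib_T14 w : NilMonoLeib (T14 w).
Proof.
apply: NilMonoLeib_strict_tri; first by do 3![elim/ord4_ind].
by move=> a i j /=; rewrite !mulS_T14; apply: funext; elim/ord4_ind; rewrite /v4 /vzero /=; ring.
Qed.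

Lemma NilMonoLeib_T12 w : NilMonoLeib (T12 w).
Proof.
apply: NilMonoLeib_strict_tri; first by do 3![elim/ord4_ind].
move=> a i j; have E m : exists c, rpow (T12 w) a m.+1 = v4 0 0 0 c.
  elim: m => [|m [c IH]] /=; first by eexists; rewrite mulS_T12 [X in v4 0 0 X](_ : _ = 0) //; ring.
  by rewrite -/(rpow (T12 w) a m.+1) IH mulS_T12 /v4 /=; exists 0; apply: eq_vec4 => /=; ring.
have [c ->] := E j; rewrite mulS_T12.
by apply: funext; elim/ord4_ind; rewrite /v4 /vzero /=; ring.
Qed.

End Reduction.

(** * Closures of families of orbits *)

Section PolynomialActions.
Variables (F : fieldType) (J : Type).

Lemma polyfun_det n (g : (J -> F) -> 'M[F]_n) :
  (forall i j, polyfun (fun y => g y i j)) -> polyfun (fun y => \det (g y)).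
Proof.
move=> hg; apply: polyfun_sum => s; apply: pf_mul; first exact: pf_const.
by apply: polyfun_prod => i; apply: hg.
Qed.

Lemma polyfun_adj n (g : (J -> F) -> 'M[F]_n) i j :
  (forall i j, polyfun (fun y => g y i j)) -> polyfun (fun y => (\adj (g y)) i j).
Proof.
move=> hg; apply: (@eq_polyfun _ _ (fun y => cofactor (g y) j i)); first by move=> y; rewrite mxE.
apply: pf_mul; first exact: pf_const.
apply: polyfun_det => k l; apply: (@eq_polyfun _ _ (fun y => g y (lift j k) (lift i l))) => //.
by move=> y; rewrite !mxE.
Qed.

Lemma polymap_comp (I K : Type) (phi : (J -> F) -> (I -> F)) (psi : (K -> F) -> (J -> F)) :
  polymap phi -> polymap psi -> polymap (fun w => phi (psi w)).
Proof. by move=> hphi hpsi i; apply: (polyfun_comp (hphi i) hpsi). Qed.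

Lemma polymap_act n (g : 'M[F]_n) (T : (J -> F) -> structure F n) :
  polymap T -> polymap (fun w => act g (T w)).
Proof.
move=> hT [[i j] k]; apply: polymap_appm; first by move=> *; apply: pf_const.
by apply: polymap_mulS => //; apply: polymap_cst.
Qed.

Lemma act_linear n (g : 'M[F]_n) c (mu : structure F n) :
  act g (fun p => c * mu p) = fun p => c * act g mu p.
Proof.
apply: funext => -[[i j] k]; rewrite /act /appm mulr_sumr; apply: eq_bigr => l _.
rewrite [RHS]mulrCA; congr (_ * _); rewrite /mulS mulr_sumr; apply: eq_bigr => i' _.
by rewrite mulr_sumr; apply: eq_bigr => j' _; rewrite mulrCA.
Qed.

(** A polynomial substitute for [act]; two inverses become adjugates, so it differs from [act] by
    the factor det(g)^2. *)
Definition adj_act n (g : 'M[F]_n) (mu : structure F n) : structure F n := fun '(i, j, k) =>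
  appm g (mulS mu (appm (\adj g) (@basis_vec F n i)) (appm (\adj g) (@basis_vec F n j))) k.

Lemma adj_actE n (g : 'M[F]_n) (mu : structure F n) : g \in unitmx ->
  adj_act g mu = act g (fun p => \det g ^+ 2 * mu p).
Proof.
move=> ug; have d0 : \det g != 0 by rewrite -unitfE -unitmxE.
have E v : appm (\adj g) v = vscale (\det g) (appm (invmx g) v).
  apply: funext => k; rewrite /appm /vscale mulr_sumr; apply: eq_bigr => l _.
  by rewrite /invmx ug [fun_of_matrix (_ *: _) k l]mxE !mulrA mulfV // mul1r.
have mulZ c x y : mulS (fun p => c * mu p) x y = vscale c (mulS mu x y).
  apply: funext => k; rewrite /mulS /vscale mulr_sumr; apply: eq_bigr => i _.
  by rewrite mulr_sumr; apply: eq_bigr => j _; rewrite mulrCA.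
apply: funext => -[[i j] k]; rewrite /adj_act /act !E mulS_scalel mulS_scaler mulZ.
by congr (appm _ _ _); apply: funext => l; rewrite /vscale mulrA.
Qed.

Lemma polymap_adj_act n (g : (J -> F) -> 'M[F]_n) (T : (J -> F) -> structure F n) :
  (forall i j, polyfun (fun y => g y i j)) -> polymap T -> polymap (fun y => adj_act (g y) (T y)).
Proof.
move=> hg hT [[i j] k]; apply: polymap_appm => //; apply: polymap_mulS => //.
all: by apply: polymap_appm; [move=> *; apply: polyfun_adj|apply: polymap_cst].
Qed.

End PolynomialActions.

Section FamilyClosures.
Variable F : numFieldType.

(** The union of orbits is the image of triples (scalar s, matrix g, parameter w) with s det(g)
    nonzero under s times [adj_act]: the scalar det(g)^-2 recovers [act], and any other nonzero
    scalar stays in the orbit by [act_scale]. *)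
Lemma zirreducible_family n (J P : Type) (tau : (J -> F) -> structure F n) (fam : P -> structure F n) :
  polymap tau -> (forall w, exists p, fam p = tau w) -> (forall p, exists w, fam p = tau w) ->
  zirreducible (family_orbit_closure fam).
Proof.
move=> htau fw wf.
pose G (y : unit + 'I_n * 'I_n + J -> F) : 'M[F]_n := \matrix_(i, j) y (inl (inr (i, j))).
pose W (y : unit + 'I_n * 'I_n + J -> F) : J -> F := fun j => y (inr j).
pose s (y : unit + 'I_n * 'I_n + J -> F) := y (inl (inl tt)).
have hG i j : polyfun (fun y => G y i j).
  by apply: (@eq_polyfun _ _ (fun y => y (inl (inr (i, j))))) => [y|]; [rewrite mxE|apply: pf_coord].
have htW : polymap (fun y => tau (W y)).
  by apply: polymap_comp => // j; apply: pf_coord.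
pose phi y : structure F n := fun p => s y * adj_act (G y) (tau (W y)) p.
have hphi : polymap phi.
  by move=> p; apply: pf_mul; [apply: pf_coord|apply: polymap_adj_act].
have hh : polyfun (fun y => s y * \det (G y)).
  by apply: pf_mul; [apply: pf_coord|apply: polyfun_det].
pose enc t (g : 'M[F]_n) (w : J -> F) : unit + 'I_n * 'I_n + J -> F := fun c =>
  match c with inl (inl _) => t | inl (inr (i, j)) => g i j | inr j => w j end.
have GE t g w : G (enc t g w) = g by apply/matrixP => i j; rewrite mxE.
apply: (zirreducible_zclosure_eq _ (@zirreducible_image _ _ _ phi _ (enc 1 1%:M (fun _ => 0)) hphi hh _)).
  move=> nu; split.
    move=> [y]; rewrite mulf_eq0 negb_or => /andP[s0 d0] ->.
    have ug : G y \in unitmx by rewrite unitmxE unitfE.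
    have [p pE] := fw (W y); exists p, ((s y * \det (G y) ^+ 2)^-1 *: G y).
    have c0 : s y * \det (G y) ^+ 2 != 0 by rewrite mulf_neq0 ?expf_neq0.
    rewrite unitmxZ ?unitfE ?invr_eq0 // -act_scale // pE; split => //.
    by apply: funext => q; rewrite /phi adj_actE // !act_linear mulrA.
  move=> [p [g [ug ->]]]; have [w ->] := wf p.
  have d0 : \det g != 0 by rewrite -unitfE -unitmxE.
  exists (enc (\det g ^- 2) g w); rewrite ?GE /s /=; first by rewrite mulf_neq0 // invr_neq0 // expf_neq0.
  rewrite /phi /s GE /W /= adj_actE // act_linear; apply: funext => q.
  by rewrite /= mulKf // expf_neq0.
by rewrite GE det1 /s /= mulr1 oner_eq0.
Qed.

(** For fixed g, a function vanishing on [A] pulls back to a polynomial in [w] that vanishes where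
    [h] is nonzero, hence everywhere; so special members are limits of generic ones. *)
Lemma zclosure_orbit_dense n (A : structure F n -> Prop) (J K : Type)
    (S : (K -> F) -> structure F n) (T : (J -> F) -> structure F n) h w0 :
  polymap T -> polyfun h -> h w0 != 0 ->
  (forall w, h w != 0 -> exists v, gl_orbit (S v) (T w)) ->
  (forall v nu, gl_orbit (S v) nu -> zclosure A nu) ->
  forall w nu, gl_orbit (T w) nu -> zclosure A nu.
Proof.
move=> hT hh h0 ST SA w nu [g [ug ->]]; apply/zclosureP => f hf fA.
apply: (@polyfun_eq0_dense _ _ (fun w => f (act g (T w))) h w0) => //.
  by apply: polyfun_comp => //; apply: polymap_act.
move=> {}w hw; have [v Sv] := ST w hw.
have /zclosureP : zclosure A (act g (T w)) by apply: (SA v); apply: gl_orbit_trans Sv _; exists g.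
exact.
Qed.

Definition act_invariant n (P : structure F n -> Prop) :=
  forall g mu, g \in unitmx -> P mu -> P (act g mu).

Lemma family_orbit_closure_min n (P : Type) (fam : P -> structure F n) (S : structure F n -> Prop) :
  zclosed S -> act_invariant S -> (forall p, S (fam p)) -> subset_of (family_orbit_closure fam) S.
Proof. by move=> cS iS Sfam; apply: zclosure_min => // nu [p [g [ug ->]]]; apply: iS. Qed.

Lemma act_invariant_orbit n (P : structure F n -> Prop) mu nu :
  act_invariant P -> gl_orbit mu nu -> P mu <-> P nu.
Proof.
move=> iP mn; split; first by case: mn => g [ug ->]; apply: iP.
by case: (gl_orbit_sym mn) => g [ug ->]; apply: iP.
Qed.

Lemma family_closure_mem n (P : Type) (fam : P -> structure F n) p : family_orbit_closure fam (fam p).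
Proof. by apply: sub_zclosure; exists p; apply: gl_orbit_refl. Qed.

Lemma zclosed_identity n (K : Type) (U V : K -> structure F n -> vec F n) :
  (forall k, polymap (U k)) -> (forall k, polymap (V k)) ->
  zclosed (fun mu => forall k, U k mu = V k mu).
Proof.
move=> hU hV; have := @zclosed_family F _ (K * 'I_n) (fun p mu => U p.1 mu p.2 - V p.1 mu p.2) _.
move/(_ (fun p => polyfun_sub (hU _ _) (hV _ _))).
suff -> : (fun mu => forall k, U k mu = V k mu) =
  (fun mu => forall k : K * 'I_n, U k.1 mu k.2 - V k.1 mu k.2 = 0) by [].
apply: funext => mu; apply: propext; split=> [H k|H k]; first by rewrite H subrr.
by apply: funext => i; apply/subr0_eq; apply: (H (k, i)).
Qed.

Section Identities.
Variable n : nat.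
Implicit Type mu : structure F n.

(** By the shift in [rpow] this is the identity ((xx)x)x = 0. *)
Definition cube_nil mu := forall x, rpow mu x 3 = @vzero F n.
Definition left_null mu := forall p : vec F n * vec F n * vec F n,
  mulS mu p.1.1 (mulS mu p.1.2 p.2) = @vzero F n.
Definition right_sym mu := forall p : vec F n * vec F n * vec F n,
  mulS mu (mulS mu p.1.1 p.1.2) p.2 = mulS mu (mulS mu p.1.1 p.2) p.1.2.
Definition square_null mu := forall p : vec F n * vec F n,
  mulS mu (mulS mu p.1 p.1) p.2 = @vzero F n.

Let hid : polymap (fun mu => mu). Proof. exact: polymap_id. Qed.
Let hcst (x : vec F n) : polymap (fun mu : structure F n => x). Proof. exact: polymap_cst. Qed.

Lemma zclosed_cube_nil : zclosed cube_nil.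
Proof. by apply: zclosed_identity => x; [apply: polymap_rpow|]. Qed.

Lemma zclosed_left_null : zclosed left_null.
Proof. by apply: zclosed_identity => p; [do ![apply: polymap_mulS => //]|]. Qed.

Lemma zclosed_right_sym : zclosed right_sym.
Proof. by apply: zclosed_identity => p; do ![apply: polymap_mulS => //]. Qed.

Lemma zclosed_square_null : zclosed square_null.
Proof. by apply: zclosed_identity => p; [do ![apply: polymap_mulS => //]|]. Qed.

Lemma cube_nil_act : act_invariant cube_nil.
Proof. by move=> g mu ug H x; rewrite -(appmVK x ug) rpow_act // H appm_vzero. Qed.

Lemma left_null_act : act_invariant left_null.
Proof.
move=> g mu ug H [[x y] z] /=; rewrite -(appmVK x ug) -(appmVK y ug) -(appmVK z ug).
by rewrite -!act_hom // (H (_, _, _)) appm_vzero.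
Qed.

Lemma right_sym_act : act_invariant right_sym.
Proof.
move=> g mu ug H [[x y] z] /=; rewrite -(appmVK x ug) -(appmVK y ug) -(appmVK z ug).
by rewrite -!act_hom // (H (_, _, _)).
Qed.

Lemma square_null_act : act_invariant square_null.
Proof.
move=> g mu ug H [x y] /=; rewrite -(appmVK x ug) -(appmVK y ug).
by rewrite -!act_hom // (H (_, _)) appm_vzero.
Qed.

End Identities.

(* The parameter of a member of the family [fam] is determined by its orbit, so an open
   set of members meets several orbits. *)
Lemma not_rigid_in_family n (X : structure F n -> Prop) (fam : F -> structure F n)
    (tau : (unit -> F) -> structure F n) mu :
  polymap tau -> (forall a, fam a = tau (fun _ => a)) -> (forall a, X (fam a)) ->
  (forall a b, gl_orbit (fam a) (fam b) -> a = b) -> act_invariant X ->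
  family_orbit_closure fam mu -> rigid_in X mu -> False.
Proof.
move=> htau famE famX inj iX Cmu [Xmu [S [[P [hP SP]] orb]]].
have nS : ~ S mu by have [] := (orb mu).1 (gl_orbit_refl mu).
have [f [Pf fmu]] : exists f, P f /\ f mu != 0.
  apply: contrapT => H; apply: nS; apply/SP => f Pf; apply/eqP; apply: contraT => fmu.
  by case: H; exists f.
have [nu [a [anu fnu]]] : exists nu a, gl_orbit (fam a) nu /\ f nu != 0.
  apply: contrapT => H; case/eqP: fmu; move/zclosureP: Cmu; apply; first exact: hP.
  move=> nu [a anu]; apply/eqP; apply: contraT => fnu.
  by case: H; exists nu, a.
have open_orbit la : X la -> f la != 0 -> gl_orbit mu la.
  by move=> Xla /eqP fla; apply/orb; split=> // /SP /(_ _ Pf).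
have [g [ug nuE]] := anu.
have hfg : polyfun (fun y => f (act g (tau y))).
  by apply: polyfun_comp (hP _ Pf) _; apply: polymap_act.
have [p Hp] := polyfun_line (fun _ : unit => 0) (fun _ => 1) hfg.
have pE b : p.[b] = f (act g (fam b)).
  by rewrite Hp famE; congr (f (act g (tau _))); apply: funext => _; rewrite add0r subr0 mulr1.
have p0 : p != 0 by apply: contra_neq fnu => p0; rewrite nuE -pE p0 horner0.
(* The same g sends [fam b] into the open set for some b other than a, so both members lie in the
   orbit of [mu]. *)
have [b pb nb] := poly_nonroot_notin [:: a] p0.
have mu_fam c : f (act g (fam c)) != 0 -> gl_orbit mu (fam c).
  move=> fc; apply: gl_orbit_trans (open_orbit _ _ fc) _; first exact: iX.
  by apply: gl_orbit_sym; exists g.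
have mua : gl_orbit mu (fam a) by apply: mu_fam; rewrite -nuE.
have mub : gl_orbit mu (fam b) by apply: mu_fam; rewrite -pE.
have := inj _ _ (gl_orbit_trans (gl_orbit_sym mua) mub).
by move=> E; move: nb; rewrite E inE eqxx.
Qed.

End FamilyClosures.

(** * Components and rigidity *)

Section Components.
Variable F : numClosedFieldType.
Implicit Types (w : nat -> F) (mu nu : structure F 4).

Local Notation X := (@NilMonoLeib F 4).
Local Notation C1 := (family_orbit_closure (fun _ : unit => L2 F)).
Local Notation C2 := (family_orbit_closure (@M12 F)).
Local Notation C3 := (family_orbit_closure (@M14 F)).

Lemma polymap_T1 : polymap (@T1 F).
Proof.
by move=> [[i j] k]; elim/ord4_ind: i; elim/ord4_ind: j; elim/ord4_ind: k;
  first [exact: pf_coord|exact: pf_const].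
Qed.

Lemma polymap_T14 : polymap (@T14 F).
Proof.
by move=> [[i j] k]; elim/ord4_ind: i; elim/ord4_ind: j; elim/ord4_ind: k;
  first [exact: pf_coord|exact: pf_const].
Qed.

Lemma polymap_T12 : polymap (@T12 F).
Proof.
by move=> [[i j] k]; elim/ord4_ind: i; elim/ord4_ind: j; elim/ord4_ind: k;
  first [exact: pf_coord|exact: pf_const|exact: polyfun_opp (pf_coord _ _)].
Qed.

Lemma T1_closure w nu : gl_orbit (T1 w) nu -> C1 nu.
Proof.
apply: (@zclosure_orbit_dense F 4 _ nat unit (fun _ => L2 F) (@T1 F)
  (fun w => w 0%N * w 3%N * w 5%N) (fun _ => 1) polymap_T1).
- by do ![apply: pf_mul]; apply: pf_coord.
- by rewrite !mulr1 oner_eq0.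
- by move=> v hv; exists (fun _ => 0); apply: T1_orbit.
- by move=> _ la Ola; apply: sub_zclosure; exists tt.
Qed.

Lemma T14_closure w nu : gl_orbit (T14 w) nu -> C3 nu.
Proof.
apply: (@zclosure_orbit_dense F 4 _ nat nat (@T14' F) (@T14 F)
  (fun w => w 9%N) (fun _ => 1) polymap_T14); [exact: pf_coord|by rewrite oner_eq0| |].
  by move=> v; apply: T14_orbit.
move=> {w nu}; apply: (@zclosure_orbit_dense F 4 _ nat unit (fun v => M14 (v tt)) (@T14' F)
  (fun w => w 9%N * w 0%N * (w 2%N - w 4%N) * (w 5%N * w 0%N - w 4%N * w 1%N))
  (* These are the parameters of [M14 0]; the all-ones point would kill the factor w 2 - w 4. *)
  (of_seq [:: 1; 0; 1; 0; 0; 1; 0; 0; 0; 1])).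
- apply: (polymap_comp polymap_T14) => n; case: eqP => _; [exact: pf_const|exact: pf_coord].
- by do ![apply: pf_mul|apply: polyfun_sub]; apply: pf_coord.
- by rewrite /of_seq /= !(mul0r, mulr1, mul1r, subr0) oner_eq0.
- by move=> v hv; have [a] := T14'_orbit hv; exists (fun _ => a).
- by move=> v la Ola; apply: sub_zclosure; exists (v tt).
Qed.

Lemma T12_closure w nu : gl_orbit (T12 w) nu -> C2 nu.
Proof.
apply: (@zclosure_orbit_dense F 4 _ nat nat (@T12_2 F) (@T12 F)
  (fun w => w 9%N) (fun _ => 1) polymap_T12); [exact: pf_coord|by rewrite oner_eq0| |].
  by move=> v; apply: T12_orbit.
move=> {w nu}; apply: (@zclosure_orbit_dense F 4 _ nat nat (@T12_3 F) (@T12_2 F)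
  (fun w => w 5%N) (fun _ => 1)); [|exact: pf_coord|by rewrite oner_eq0| |].
- apply: (polymap_comp polymap_T12); move=> n; do 9?[case: n => [|n]] => /=;
    first [exact: pf_coord|exact: pf_const|exact: polyfun_opp (pf_coord _ _)].
- by move=> v; apply: T12_2_orbit.
apply: (@zclosure_orbit_dense F 4 _ nat nat (@T12_4 F) (@T12_3 F)
  (fun w => w 4%N) (fun _ => 1)); [|exact: pf_coord|by rewrite oner_eq0| |].
- apply: (polymap_comp polymap_T12); move=> n; do 9?[case: n => [|n]] => /=;
    first [exact: pf_coord|exact: pf_const|exact: polyfun_opp (pf_coord _ _)].
- by move=> v; apply: T12_3_orbit.
apply: (@zclosure_orbit_dense F 4 _ nat unit (fun v => M12 (v tt)) (@T12_4 F)
  (fun w => w 1%N * w 4%N * w 5%N * w 9%N) (fun _ => 1)).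
- apply: (polymap_comp polymap_T12); move=> n; do 9?[case: n => [|n]] => /=;
    first [exact: pf_coord|exact: pf_const|exact: polyfun_opp (pf_coord _ _)].
- by do ![apply: pf_mul]; apply: pf_coord.
- by rewrite !mulr1 oner_eq0.
- by move=> v hv; have [a] := T12_4_orbit hv; exists (fun _ => a).
- by move=> v la Ola; apply: sub_zclosure; exists (v tt).
Qed.

Lemma NilMonoLeib_cover mu : X mu -> C1 mu \/ C2 mu \/ C3 mu.
Proof.
move=> /NilMonoLeib_reduction[w []] Ow; first by left; apply: T1_closure Ow.
  by right; right; apply: T14_closure Ow.
by right; left; apply: T12_closure Ow.
Qed.

Lemma clL2_sub : subset_of C1 X.
Proof.
apply: family_orbit_closure_min; first exact: zclosed_NilMonoLeib.
  by move=> g mu; apply: NilMonoLeib_act.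
by move=> _; rewrite L2_T1; apply: NilMonoLeib_T1.
Qed.

Lemma clM12_sub : subset_of C2 X.
Proof.
apply: family_orbit_closure_min; first exact: zclosed_NilMonoLeib.
  by move=> g mu; apply: NilMonoLeib_act.
by move=> a; rewrite M12_T12; apply: NilMonoLeib_T12.
Qed.

Lemma clM14_sub : subset_of C3 X.
Proof.
apply: family_orbit_closure_min; first exact: zclosed_NilMonoLeib.
  by move=> g mu; apply: NilMonoLeib_act.
by move=> a; rewrite M14_T14; apply: NilMonoLeib_T14.
Qed.

Lemma clL2_irr : zirreducible C1.
Proof.
apply: (@zirreducible_family F 4 unit unit (fun _ => L2 F)).
- exact: polymap_cst.
- by move=> _; exists tt.
- by move=> _; exists (fun _ => 0).
Qed.

Lemma polymap_M12 : polymap (fun v : unit -> F => M12 (v tt)).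
Proof.
by move=> [[i j] k]; elim/ord4_ind: i; elim/ord4_ind: j; elim/ord4_ind: k;
  first [exact: pf_coord|exact: pf_const].
Qed.

Lemma polymap_M14 : polymap (fun v : unit -> F => M14 (v tt)).
Proof.
by move=> [[i j] k]; elim/ord4_ind: i; elim/ord4_ind: j; elim/ord4_ind: k;
  first [exact: pf_coord|exact: pf_const].
Qed.

Lemma clM12_irr : zirreducible C2.
Proof.
apply: (@zirreducible_family F 4 unit F (fun v => M12 (v tt)) _ polymap_M12).
- by move=> v; exists (v tt).
- by move=> a; exists (fun _ => a).
Qed.

Lemma clM14_irr : zirreducible C3.
Proof.
apply: (@zirreducible_family F 4 unit F (fun v => M14 (v tt)) _ polymap_M14).
- by move=> v; exists (v tt).
- by move=> a; exists (fun _ => a).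
Qed.

(** * Identities separating the three closures *)

Local Notation e_ := (@basis_vec F 4).

Lemma cube_nil_T14 w : cube_nil (T14 w).
Proof.
by move=> x; rewrite /= !mulS_T14; apply: funext; elim/ord4_ind; rewrite /v4 /vzero /=; ring.
Qed.

Lemma cube_nil_T12 w : cube_nil (T12 w).
Proof.
by move=> x; rewrite /= !mulS_T12; apply: funext; elim/ord4_ind; rewrite /v4 /vzero /=; ring.
Qed.

Lemma left_null_T1 w : left_null (T1 w).
Proof.
by move=> p; rewrite !mulS_T1; apply: funext; elim/ord4_ind; rewrite /v4 /vzero /=; ring.
Qed.

Lemma left_null_T14 w : left_null (T14 w).
Proof.
by move=> p; rewrite !mulS_T14; apply: funext; elim/ord4_ind; rewrite /v4 /vzero /=; ring.
Qed.

Lemma right_sym_T1 w : right_sym (T1 w).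
Proof.
by move=> p; rewrite !mulS_T1; apply: funext; elim/ord4_ind; rewrite /v4 /=; ring.
Qed.

Lemma square_null_T12 w : w 6%N = - w 5%N -> w 8%N = 0 -> w 7%N = 0 -> square_null (T12 w).
Proof.
by move=> E6 E8 E7 p; rewrite !mulS_T12 /=; apply: funext;
  elim/ord4_ind; rewrite /v4 /vzero /= ?E6 ?E7 ?E8; ring.
Qed.

Lemma rpow3_T1 w x : rpow (T1 w) x 3 = v4 0 0 0 (w 0%N * w 3%N * w 5%N * x o0 ^+ 4).
Proof. by rewrite /= !mulS_T1; apply: eq_vec4; rewrite /v4 /=; ring. Qed.

Lemma L2_not_cube_nil : ~ @cube_nil F 4 (L2 F).
Proof.
move=> /(_ (e_ o0)) /(congr1 (fun v => v o3)); rewrite L2_T1 rpow3_T1 /v4 /vzero /of_seq /=.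
by rewrite /basis_vec /= expr1n !mulr1 => /eqP; rewrite oner_eq0.
Qed.

Lemma M12_not_left_null a : ~ @left_null F 4 (M12 a).
Proof.
move=> /(_ (e_ o0, e_ o0, e_ o1)) /(congr1 (fun v => v o3)); rewrite M12_T12 /= !mulS_T12.
rewrite /v4 /vzero /of_seq /= /basis_vec /= => /eqP.
by rewrite !(mulr0, mul0r, addr0, add0r, mulr1, subr0) oner_eq0.
Qed.

Lemma M14_not_right_sym a : ~ @right_sym F 4 (M14 a).
Proof.
move=> /(_ (e_ o0, e_ o0, e_ o1)) /(congr1 (fun v => v o3)); rewrite M14_T14 /= !mulS_T14.
rewrite /v4 /of_seq /= /basis_vec /= => /eqP.
by rewrite !(mulr0, mul0r, addr0, add0r, mulr1, subr0) oner_eq0.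
Qed.

Lemma M14_not_square_null a : ~ @square_null F 4 (M14 a).
Proof.
move=> /(_ (e_ o0, e_ o1)) /(congr1 (fun v => v o3)); rewrite M14_T14 /= !mulS_T14.
rewrite /v4 /vzero /of_seq /= /basis_vec /= => /eqP.
by rewrite !(mulr0, mul0r, addr0, add0r, mulr1, subr0) oner_eq0.
Qed.

Lemma clM12_cube_nil : subset_of C2 (@cube_nil F 4).
Proof.
apply: family_orbit_closure_min; [exact: zclosed_cube_nil|exact: cube_nil_act|].
by move=> a; rewrite M12_T12; apply: cube_nil_T12.
Qed.

Lemma clM14_cube_nil : subset_of C3 (@cube_nil F 4).
Proof.
apply: family_orbit_closure_min; [exact: zclosed_cube_nil|exact: cube_nil_act|].
by move=> a; rewrite M14_T14; apply: cube_nil_T14.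
Qed.

Lemma clL2_left_null : subset_of C1 (@left_null F 4).
Proof.
apply: family_orbit_closure_min; [exact: zclosed_left_null|exact: left_null_act|].
by move=> _; rewrite L2_T1; apply: left_null_T1.
Qed.

Lemma clM14_left_null : subset_of C3 (@left_null F 4).
Proof.
apply: family_orbit_closure_min; [exact: zclosed_left_null|exact: left_null_act|].
by move=> a; rewrite M14_T14; apply: left_null_T14.
Qed.

Lemma clL2_right_sym : subset_of C1 (@right_sym F 4).
Proof.
apply: family_orbit_closure_min; [exact: zclosed_right_sym|exact: right_sym_act|].
by move=> _; rewrite L2_T1; apply: right_sym_T1.
Qed.

Lemma clM12_square_null : subset_of C2 (@square_null F 4).
Proof.
apply: family_orbit_closure_min; [exact: zclosed_square_null|exact: square_null_act|].
by move=> a; rewrite M12_T12; apply: square_null_T12.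
Qed.

Lemma clL2_nsub_clM12 : ~ subset_of C1 C2.
Proof.
move=> sub; apply: L2_not_cube_nil; apply: clM12_cube_nil; apply: sub.
exact: (@family_closure_mem F 4 unit (fun _ => L2 F) tt).
Qed.

Lemma clL2_nsub_clM14 : ~ subset_of C1 C3.
Proof.
move=> sub; apply: L2_not_cube_nil; apply: clM14_cube_nil; apply: sub.
exact: (@family_closure_mem F 4 unit (fun _ => L2 F) tt).
Qed.

Lemma clM12_nsub_clL2 : ~ subset_of C2 C1.
Proof.
move=> sub; apply: (@M12_not_left_null 0); apply: clL2_left_null; apply: sub.
exact: family_closure_mem.
Qed.

Lemma clM12_nsub_clM14 : ~ subset_of C2 C3.
Proof.
move=> sub; apply: (@M12_not_left_null 0); apply: clM14_left_null; apply: sub.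
exact: family_closure_mem.
Qed.

Lemma clM14_nsub_clL2 : ~ subset_of C3 C1.
Proof.
move=> sub; apply: (@M14_not_right_sym 0); apply: clL2_right_sym; apply: sub.
exact: family_closure_mem.
Qed.

Lemma clM14_nsub_clM12 : ~ subset_of C3 C2.
Proof.
move=> sub; apply: (@M14_not_square_null 0); apply: clM12_square_null; apply: sub.
exact: family_closure_mem.
Qed.

Lemma subset_antisym (T : Type) (A B : T -> Prop) : subset_of A B -> subset_of B A -> A = B.
Proof. by move=> AB BA; apply: funext => x; apply: propext; split; [apply: AB|apply: BA]. Qed.

Lemma irreducible_sub_component Y : zirreducible Y -> subset_of Y X ->
  [\/ subset_of Y C1, subset_of Y C2 | subset_of Y C3].
Proof.
move=> [_ [_ irr]] YX; have [c1 _] := clL2_irr; have [c2 _] := clM12_irr; have [c3 _] := clM14_irr.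
have cU : zclosed (fun mu => C2 mu \/ C3 mu).
  have [P [hP CP]] := c2; have [Q [hQ CQ]] := c3.
  exists (fun f => exists g h, [/\ P g, Q h & f = fun x => g x * h x]); split.
    by move=> _ [g [h [Pg Qh ->]]]; apply: pf_mul; [apply: hP|apply: hQ].
  move=> mu; split.
    move=> [/CP H|/CQ H] _ [g [h [Pg Qh ->]]]; first by rewrite H // mul0r.
    by rewrite (H h) // mulr0.
  move=> H; have [|nC2] := asboolP (C2 mu); first by left.
  right; apply/CQ => h Qh; apply/eqP; apply: contraT => hmu.
  case: nC2; apply/CP => g Pg; apply/eqP.
  have /eqP : g mu * h mu = 0 by apply: (H (fun x => g x * h x)); exists g, h.
  by rewrite mulf_eq0 (negbTE hmu) orbF.
case: (irr _ _ c1 cU); [by move=> mu /YX/NilMonoLeib_cover|by constructor 1|].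
by move=> sub; case: (irr _ _ c2 c3 sub); [constructor 2|constructor 3].
Qed.

Lemma zcomponentP Y : zcomponent X Y <-> (Y = C1 \/ Y = C2 \/ Y = C3).
Proof.
split=> [[irrY [YX max]]|].
  case: (irreducible_sub_component irrY YX) => sub; [left|right; left|right; right]; symmetry;
    apply: max => //.
  - exact: clL2_irr.
  - exact: clL2_sub.
  - exact: clM12_irr.
  - exact: clM12_sub.
  - exact: clM14_irr.
  - exact: clM14_sub.
have sub_trans (A B D : structure F 4 -> Prop) : subset_of A B -> subset_of B D -> subset_of A D.
  by move=> AB BD x /AB/BD.
case=> [->|[->|->]].
- split; first exact: clL2_irr; split; first exact: clL2_sub; move=> Z irrZ CZ ZX.
  case: (irreducible_sub_component irrZ ZX) => sub; first exact: subset_antisym.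
    by case: clL2_nsub_clM12; apply: sub_trans CZ sub.
  by case: clL2_nsub_clM14; apply: sub_trans CZ sub.
- split; first exact: clM12_irr; split; first exact: clM12_sub; move=> Z irrZ CZ ZX.
  case: (irreducible_sub_component irrZ ZX) => sub; last 1 first.
  + by case: clM12_nsub_clM14; apply: sub_trans CZ sub.
  + by case: clM12_nsub_clL2; apply: sub_trans CZ sub.
  + exact: subset_antisym.
- split; first exact: clM14_irr; split; first exact: clM14_sub; move=> Z irrZ CZ ZX.
  case: (irreducible_sub_component irrZ ZX) => sub; last exact: subset_antisym.
    by case: clM14_nsub_clL2; apply: sub_trans CZ sub.
  by case: clM14_nsub_clM12; apply: sub_trans CZ sub.
Qed.

(** * Isomorphisms within the families and rigidity *)

Lemma orbit_frame nu mu : gl_orbit nu mu -> exists f : 'I_4 -> vec F 4,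
  (forall i, f i <> @vzero F 4) /\
  forall i j, mulS mu (f i) (f j) = fun k => f o0 k * nu (i, j, o0) + f o1 k * nu (i, j, o1)
     + f o2 k * nu (i, j, o2) + f o3 k * nu (i, j, o3).
Proof.
move=> [g [ug ->]]; exists (fun i => appm g (e_ i)); split.
  move=> i E; have := congr1 (appm (invmx g)) E; rewrite appmK // appm_vzero.
  by move/(congr1 (fun v => v i)); rewrite /basis_vec eqxx /vzero => /eqP; rewrite oner_eq0.
move=> i j; rewrite -act_hom //; apply: funext => k; rewrite {1}/appm sum4 !mulS_basis.
by rewrite !appm_basis.
Qed.

Let half (u : F) : 2 * u = 0 -> u = 0.
Proof. by move/eqP; rewrite mulf_eq0 pnatr_eq0 /= => /eqP. Qed.

Let cancel (u v : F) : u * v = 0 -> u != 0 -> v = 0.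
Proof. by move=> /eqP; rewrite mulf_eq0 => /orP[/eqP ->|/eqP //]; rewrite eqxx. Qed.

Lemma M12_inj (a b : F) : @gl_orbit F 4 (M12 a) (M12 b) -> a = b.
Proof.
move=> /orbit_frame[f [f0 H]].
pose x := f o0; pose y := f o1; pose z := f o2; pose t := f o3.
pose w := of_seq [:: b; 1; 0; 0; 1; 1; -1; 0; 0; 1].
(* [G i j k] is the k-th coordinate of the relation for f_i f_j. In turn the relations yield z in
   <e_3, e_4>, t = c^2 e_4, x o0 = c, y o1 = 1 and c^2 = 1; then f_1 f_1 = a f_4 reads b = a. *)
have G i j k := congr1 (fun v => v k)
  (etrans (esym (mulS_T12 w (f i) (f j))) (etrans (congr1 (fun m => mulS m _ _) (esym (M12_T12 b))) (H i j))).
have z0 : z o0 = 0 by apply: (eq_by_sub (esym (G o0 o1 o0))); rewrite /v4 /w /of_seq /x /y /z /t /=; ring.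
have z1 : z o1 = 0 by apply: (eq_by_sub (esym (G o0 o1 o1))); rewrite /v4 /w /of_seq /x /y /z /t /=; ring.
pose c := z o2.
have cE : x o0 * y o1 - x o1 * y o0 = c.
  by apply: (eq_by_sub (G o0 o1 o2)); rewrite /v4 /w /of_seq /c /x /y /z /=; ring.
have t0 : t o0 = 0 by apply: (eq_by_sub (esym (G o1 o1 o0))); rewrite /v4 /w /of_seq /x /y /z /t /=; ring.
have t1 : t o1 = 0 by apply: (eq_by_sub (esym (G o1 o1 o1))); rewrite /v4 /w /of_seq /x /y /z /t /=; ring.
have t2 : t o2 = 0 by apply: (eq_by_sub (esym (G o1 o1 o2))); rewrite /v4 /w /of_seq /x /y /z /t /=; ring.
have e := G o2 o2 o3; rewrite /v4 /w /of_seq /= -/z -/t -/c z0 z1 in e.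
have t3 : t o3 = c ^+ 2 by apply: (eq_by_sub (esym e)); ring.
have c0 : c != 0.
  apply/eqP => c0; apply: (f0 o3); apply: funext; elim/ord4_ind => //.
  by rewrite -/t t3 c0 /vzero expr0n.
have e1 := G o0 o2 o3; rewrite /v4 /w /of_seq /= -/x -/z -/t -/c z0 z1 t3 in e1.
have e2 := G o2 o0 o3; rewrite /v4 /w /of_seq /= -/x -/z -/t -/c z0 z1 t3 in e2.
have e3 := G o1 o2 o3; rewrite /v4 /w /of_seq /= -/y -/z -/t -/c z0 z1 t3 in e3.
have e4 := G o2 o1 o3; rewrite /v4 /w /of_seq /= -/y -/z -/t -/c z0 z1 t3 in e4.
have x2 : x o2 = 0.
  apply: (fun h => cancel h c0); apply: half.
  by apply: (eq_by_sub (congr2 +%R e1 e2)); ring.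
have x0 : x o0 = c.
  apply/subr0_eq; apply: (fun h => cancel h c0).
  by apply: (eq_by_sub e1); rewrite x2; ring.
have y2 : y o2 = 0.
  apply: (fun h => cancel h c0); apply: half.
  by apply: (eq_by_sub (congr2 +%R e3 e4)); ring.
have y0 : y o0 = 0.
  by apply: (fun h => cancel h c0); apply: (eq_by_sub e3); rewrite y2; ring.
have y1 : y o1 = 1.
  apply/subr0_eq; apply: (fun h => cancel h c0).
  by apply: (eq_by_sub cE); rewrite x0 y0; ring.
have e5 := G o1 o1 o3; rewrite /v4 /w /of_seq /= -/x -/y -/z -/t t3 y0 y1 y2 in e5.
have c2 : c ^+ 2 = 1 by apply: (eq_by_sub (esym e5)); ring.
have e6 := G o0 o1 o3; rewrite /v4 /w /of_seq /= -/x -/y -/z -/t y0 y1 y2 x0 x2 in e6.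
have e7 := G o1 o0 o3; rewrite /v4 /w /of_seq /= -/x -/y -/z -/t y0 y1 y2 x0 x2 in e7.
have x1 : x o1 = 0.
  by apply: half; apply: (eq_by_sub (congr2 +%R e6 e7)); ring.
have e8 := G o0 o0 o3; rewrite /v4 /w /of_seq /= -/x -/y -/z -/t t3 c2 x0 x1 x2 in e8.
have e9 : b * c ^+ 2 = a by apply: (eq_by_sub e8); ring.
by rewrite -e9 c2 mulr1.
Qed.

Lemma M14_inj (a b : F) : @gl_orbit F 4 (M14 a) (M14 b) -> a = b.
Proof.
move=> /orbit_frame[f [f0 H]].
pose x := f o0; pose y := f o1; pose z := f o2; pose t := f o3.
pose w := of_seq [:: 1; 0; 1; 0; 0; 1; b; 0; 0; 1].
(* The same comparison gives here x o1 = y o0 = 0, c = (x o0)^2 and y o1 = x o0; then f_2 f_1 = f_4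
   forces x o0 = 1, and f_2 f_2 = a f_3 reads b = a. *)
have G i j k := congr1 (fun v => v k)
  (etrans (esym (mulS_T14 w (f i) (f j))) (etrans (congr1 (fun m => mulS m _ _) (esym (M14_T14 b))) (H i j))).
have z0 : z o0 = 0 by apply: (eq_by_sub (esym (G o0 o0 o0))); rewrite /v4 /w /of_seq /x /y /z /t /=; ring.
have z1 : z o1 = 0 by apply: (eq_by_sub (esym (G o0 o0 o1))); rewrite /v4 /w /of_seq /x /y /z /t /=; ring.
pose c := z o2.
have t0 : t o0 = 0 by apply: (eq_by_sub (esym (G o2 o1 o0))); rewrite /v4 /w /of_seq /x /y /z /t /=; ring.
have t1 : t o1 = 0 by apply: (eq_by_sub (esym (G o2 o1 o1))); rewrite /v4 /w /of_seq /x /y /z /t /=; ring.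
have e := G o2 o1 o2; rewrite /v4 /w /of_seq /= -/x -/y -/z -/t -/c z0 z1 in e.
have t2 : t o2 = 0 by apply: (eq_by_sub (esym e)); ring.
have e' := G o2 o1 o3; rewrite /v4 /w /of_seq /= -/x -/y -/z -/t -/c z0 z1 in e'.
have t3 : t o3 = c * y o1 by apply: (eq_by_sub (esym e')); ring.
have : c * y o1 != 0.
  apply/eqP => c0; apply: (f0 o3); apply: funext; elim/ord4_ind => //.
  by rewrite -/t t3 c0.
rewrite mulf_eq0 negb_or => /andP[c0 y1n].
have e1 := G o2 o0 o3; rewrite /v4 /w /of_seq /= -/x -/y -/z -/t -/c z0 z1 in e1.
have x1 : x o1 = 0 by apply: (fun h => cancel h c0); apply: (eq_by_sub e1); ring.
have e2 := G o0 o0 o2; rewrite /v4 /w /of_seq /= -/x -/y -/z -/t -/c x1 in e2.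
have x0c : x o0 ^+ 2 = c by apply: (eq_by_sub e2); ring.
have x0n : x o0 != 0 by apply: contra_neq c0 => x0; rewrite -x0c x0 expr0n.
have e3 := G o1 o0 o2; rewrite /v4 /w /of_seq /= -/x -/y -/z -/t -/c x1 t2 in e3.
have y0 : y o0 = 0 by apply: (fun h => cancel h x0n); apply: (eq_by_sub e3); ring.
have e4 := G o0 o1 o2; rewrite /v4 /w /of_seq /= -/x -/y -/z -/t -/c x1 y0 -x0c in e4.
have y1 : y o1 = x o0.
  by apply/subr0_eq; apply: (fun h => cancel h x0n); apply: (eq_by_sub e4); ring.
have e5 := G o1 o0 o3; rewrite /v4 /w /of_seq /= -/x -/y -/z -/t -/c x1 y0 y1 t3 y1 in e5.
have x0 : x o0 = 1.
  apply/subr0_eq/eqP; rewrite -oppr_eq0 opprB; apply/eqP.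
  apply: (fun h => cancel h (expf_neq0 2 x0n)); apply: (eq_by_sub e5); rewrite -x0c; ring.
have e6 := G o1 o1 o2; rewrite /v4 /w /of_seq /= -/x -/y -/z -/t -/c y0 y1 x0 t2 -x0c x0 in e6.
by apply: (eq_by_sub (esym e6)); ring.
Qed.

Lemma rigid_L2 : rigid_in X (L2 F).
Proof.
have nulL2 := L2_not_cube_nil.
split; first by rewrite L2_T1; apply: NilMonoLeib_T1.
exists (@cube_nil F 4); split; first exact: zclosed_cube_nil.
move=> nu; split=> [On|[Xnu ncube]].
  split; last by move/(act_invariant_orbit (@cube_nil_act F 4) On).
  by case: On => g [ug ->]; apply: NilMonoLeib_act => //; rewrite L2_T1; apply: NilMonoLeib_T1.
have [w [Ow|Ow|Ow]] := NilMonoLeib_reduction Xnu.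
- apply: (gl_orbit_trans _ Ow); apply: T1_orbit; apply/eqP => w0; apply: ncube.
  apply/(act_invariant_orbit (@cube_nil_act F 4) Ow) => x.
  by rewrite rpow3_T1 w0 mul0r; apply: funext; elim/ord4_ind.
- case: ncube; apply/(act_invariant_orbit (@cube_nil_act F 4) Ow); exact: cube_nil_T14.
- case: ncube; apply/(act_invariant_orbit (@cube_nil_act F 4) Ow); exact: cube_nil_T12.
Qed.

(** In the closure of L2, the open orbit of [nu] must meet the dense orbit of L2; the other two
    closures are excluded because their parameters are isomorphism invariants. *)
Lemma rigid_orbit_L2 nu : rigid_in X nu -> gl_orbit (L2 F) nu.
Proof.
have iX : act_invariant X by move=> g mu; apply: NilMonoLeib_act.
move=> rig; have [Xnu [S [[P [hP SP]] orb]]] := rig.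
case: (NilMonoLeib_cover Xnu) => [Cnu|[Cnu|Cnu]].
- have nS : ~ S nu by have [] := (orb nu).1 (gl_orbit_refl nu).
  have [f [Pf fnu]] : exists f, P f /\ f nu != 0.
    apply: contrapT => H; apply: nS; apply/SP => f Pf; apply/eqP; apply: contraT => fnu.
    by case: H; exists f.
  have [la [Ola fla]] : exists la, gl_orbit (L2 F) la /\ f la != 0.
    apply: contrapT => H; case/eqP: fnu; move/zclosureP: Cnu; apply; first exact: hP.
    by move=> la [_ Ola]; apply/eqP; apply: contraT => fla; case: H; exists la.
  have /orb : X la /\ ~ S la.
    split; last by move=> /SP /(_ _ Pf) /eqP; rewrite (negbTE fla).
    by case: Ola => g [ug ->]; apply: iX => //; rewrite L2_T1; apply: NilMonoLeib_T1.
  by move=> /gl_orbit_sym; apply: gl_orbit_trans.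
- case: (@not_rigid_in_family F 4 X (@M12 F) _ nu polymap_M12 _ _ M12_inj iX Cnu rig) => // a.
  by rewrite M12_T12; apply: NilMonoLeib_T12.
- case: (@not_rigid_in_family F 4 X (@M14 F) _ nu polymap_M14 _ _ M14_inj iX Cnu rig) => // a.
  by rewrite M14_T14; apply: NilMonoLeib_T14.
Qed.

End Components.

(** * Dimension fifteen *)

Section Dimension.
Variable F : numClosedFieldType.
Implicit Types (w : nat -> F) (mu nu : structure F 4).

Local Notation X := (@NilMonoLeib F 4).
Local Notation C1 := (family_orbit_closure (fun _ : unit => L2 F)).
Local Notation C2 := (family_orbit_closure (@M12 F)).
Local Notation C3 := (family_orbit_closure (@M14 F)).
Local Notation e_ := (@basis_vec F 4).

(** Padding by zeros links the finite index set required by the monomial count with parameters given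
    as sequences. *)
Definition extend0 d (v : 'I_d -> F) : nat -> F := fun n => if insub n is Some i then v i else 0.

Lemma extend0_of_seq (s : seq F) d : (size s <= d)%N ->
  extend0 (fun i : 'I_d => of_seq s i) = of_seq s.
Proof.
move=> sd; apply: funext => n; rewrite /extend0; case: insubP => [i _ -> //|].
by rewrite -leqNgt => dn; rewrite /of_seq nth_default // (leq_trans sd dn).
Qed.

(** Matrices with h(g) nonzero are dense in GL_4, so only they have to be sent into [A]. The scalar
    [c] is there because the proof moves along [adj_act]. *)
Lemma zclosure_cell (A : structure F 4 -> Prop) (h : ('I_4 * 'I_4 -> F) -> F) g0 mu :
  polyfun h -> h g0 != 0 ->
  (forall (g : 'M[F]_4) c, g \in unitmx -> h (fun p => g p.1 p.2) != 0 -> A (act g (fun p => c * mu p))) ->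
  forall nu, gl_orbit mu nu -> zclosure A nu.
Proof.
move=> hh h0 HA nu [g [ug ->]]; apply/zclosureP => f hf fA.
pose G (y : 'I_4 * 'I_4 -> F) : 'M[F]_4 := \matrix_(i, j) y (i, j).
have hG i j : polyfun (fun y => G y i j).
  by apply: (@eq_polyfun _ _ (fun y => y (i, j))) => [y|]; [rewrite mxE|apply: pf_coord].
have GE (M : 'M[F]_4) : G (fun p => M p.1 p.2) = M by apply/matrixP => i j; rewrite mxE.
(* This constant cancels det(g)^2 at the target matrix [g], so [Q] takes the value f(act g mu)
   there. *)
pose d := \det g ^- 2.
pose Q y := f (adj_act (G y) (fun p => d * mu p)).
have hQ : polyfun Q by apply: polyfun_comp hf _; apply: polymap_adj_act => //; apply: polymap_cst.
have hd : polyfun (fun y => \det (G y)) by apply: polyfun_det.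
have G1 : \det (G (fun p => (1%:M : 'M[F]_4) p.1 p.2)) != 0.
  by rewrite GE det1 oner_eq0.
have [y0 [hy0 dy0]] := polyfun_common_nonzero hh hd h0 G1.
have : Q (fun p => g p.1 p.2) = 0.
  apply: (@polyfun_eq0_dense _ _ Q (fun y => h y * \det (G y)) y0) => //.
  - exact: pf_mul.
  - by rewrite mulf_neq0.
  move=> y; rewrite mulf_eq0 negb_or => /andP[hy dy].
  have uG : G y \in unitmx by rewrite unitmxE unitfE.
  rewrite /Q adj_actE //; apply: fA.
  have -> : (fun p => \det (G y) ^+ 2 * (d * mu p)) = (fun p => (\det (G y) ^+ 2 * d) * mu p).
    by apply: funext => p; rewrite mulrA.
  apply: HA => //; suff -> : (fun p => G y p.1 p.2) = y by [].
  by apply: funext => -[i j]; rewrite mxE.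
rewrite /Q GE adj_actE //; suff -> : (fun p => \det g ^+ 2 * (d * mu p)) = mu by [].
have d0 : \det g != 0 by rewrite -unitfE -unitmxE.
by apply: funext => p; rewrite /d mulrA mulfV ?mul1r // expf_neq0.
Qed.

(* [y] acts on the right through a linear form [xi]: [x y = xi(y) R x] with [xi \o R = 0],
   normalized by [xi(e_1) = 1]. *)
Definition rank1 w : structure F 4 := fun '(i, j, k) =>
  match nat_of_ord j with 0 => 1 | 1 => w 0%N | 2 => w 1%N | _ => w 2%N end *
  match nat_of_ord k with
  | 0 => - (w 0%N * w (3 + i)%N + w 1%N * w (7 + i)%N + w 2%N * w (11 + i)%N)
  | 1 => w (3 + i)%N | 2 => w (7 + i)%N | _ => w (11 + i)%N end.

Lemma polymap_rank1 : polymap rank1.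
Proof.
by move=> [[i j] k]; elim/ord4_ind: j; elim/ord4_ind: k; rewrite /rank1 /=;
  do ?[exact: pf_coord|exact: pf_const|apply: pf_mul|apply: polyfun_opp|apply: pf_add].
Qed.

(** Dividing [eta] by its first entry leaves 3 ratios; the condition that [eta] kills [R] determines
    the first coordinate of each R e_i, leaving 12 entries. *)
Lemma rank1_of (eta : vec F 4) (R : 'I_4 -> vec F 4) : eta o0 != 0 ->
  (forall i, eta o0 * R i o0 + eta o1 * R i o1 + eta o2 * R i o2 + eta o3 * R i o3 = 0) ->
  exists v : 'I_15 -> F, (fun '(i, j, k) => eta j * R i k) = rank1 (extend0 v).
Proof.
move=> n0 H; pose r i k := eta o0 * R i k.
pose s := [:: eta o1 / eta o0; eta o2 / eta o0; eta o3 / eta o0;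
  r o0 o1; r o1 o1; r o2 o1; r o3 o1; r o0 o2; r o1 o2; r o2 o2; r o3 o2;
  r o0 o3; r o1 o3; r o2 o3; r o3 o3].
exists (fun i => of_seq s i); rewrite extend0_of_seq //.
apply: eq_structure4 => i j k.
have E : R i o0 = - (eta o1 / eta o0 * R i o1 + eta o2 / eta o0 * R i o2 + eta o3 / eta o0 * R i o3).
  apply: (mulfI n0); by apply: (eq_by_sub (H i)); field.
elim/ord4_ind: k; rewrite ?E; elim/ord4_ind: j; elim/ord4_ind: i {E};
  by rewrite /rank1 /of_seq /s /r /=; field.
Qed.

Lemma clL2_sub_rank1 : subset_of C1 (zclosure (fun nu => exists v : 'I_15 -> F, nu = rank1 (extend0 v))).
Proof.
apply: zclosure_min; first exact: zclosed_zclosure.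
move=> nu [_ Onu].
(* In L2, x y is the first coordinate of y times the shift of x, so after transport by g the linear
   form is the first row of the inverse of g. Its first entry is nonzero exactly when this adjugate
   entry is. *)
pose h (y : 'I_4 * 'I_4 -> F) := (\adj (\matrix_(i, j) y (i, j) : 'M[F]_4)) o0 o0.
apply: (@zclosure_cell _ h (fun p => (1%:M : 'M[F]_4) p.1 p.2) (L2 F)) Onu.
- apply: polyfun_adj => i j.
  by apply: (@eq_polyfun _ _ (fun y => y (i, j))) => [y|]; [rewrite mxE|apply: pf_coord].
- rewrite /h; have -> : \matrix_(i, j) (1%:M : 'M[F]_4) (i, j).1 (i, j).2 = 1%:M.
    by apply/matrixP => i j; rewrite mxE.
  have -> : \adj (1%:M : 'M[F]_4) = 1%:M.
    by have := mul_mx_adj (1%:M : 'M[F]_4); rewrite det1 mul1mx.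
  by rewrite mxE oner_eq0.
move=> g c ug; rewrite /h; have -> : \matrix_(i, j) g (i, j).1 (i, j).2 = g.
  by apply/matrixP => i j; rewrite mxE.
move=> a0; pose q := invmx g; pose eta : vec F 4 := fun j => q o0 j.
pose R i : vec F 4 := appm g (v4 0 (c * q o0 i) (c * q o1 i) (c * q o2 i)).
have n0 : eta o0 != 0.
  have d0 : \det g != 0 by rewrite -unitfE -unitmxE.
  by rewrite /eta /q /invmx ug [fun_of_matrix (_ *: _) _ _]mxE mulf_neq0 // invr_neq0.
have eR i : eta o0 * R i o0 + eta o1 * R i o1 + eta o2 * R i o2 + eta o3 * R i o3 = 0.
  have := congr1 (fun v => v o0) (appmK (v4 0 (c * q o0 i) (c * q o1 i) (c * q o2 i)) ug).
  by rewrite {1}/appm sum4.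
have [v vE] := rank1_of n0 eR; exists v; rewrite -vE.
apply: eq_structure4 => i j k.
rewrite act_linear /act L2_T1 mulS_T1 !appm_basis /R /appm !sum4 /v4 /of_seq /= -/q /eta.
by ring.
Qed.

(** A chart of the flags <e_4> < <e_3, e_4>. The numbering of the entries is the order in which the
    chain of strata switches them on. *)
Definition flagU w : 'M[F]_4 := cols4 (frame (v4 1 0 0 0) (v4 0 1 0 0)
  (v4 (w 11%N) (w 12%N) 1 0) (v4 (w 13%N) (w 14%N) (w 10%N) 1)).

Lemma det_flagU w : \det (flagU w) = 1.
Proof.
rewrite -det_tr det_trig.
  by rewrite big1 //; elim/ord4_ind => _; rewrite !mxE.
by apply/is_trig_mxP; do 2![elim/ord4_ind] => //; rewrite !mxE.
Qed.

Lemma flagU_unit w : flagU w \in unitmx.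
Proof. by rewrite unitmxE det_flagU unitr1. Qed.

(* The parameters [w 0 .. w 9] are coordinates on the linear space [T], and [w 10 .. w 14] are the
   entries of the unipotent matrix moving the flag. *)
Definition flag_param (T : (nat -> F) -> structure F 4) w := adj_act (flagU w) (T w).

Lemma flag_paramE T w : flag_param T w = act (flagU w) (T w).
Proof.
rewrite /flag_param adj_actE ?flagU_unit // det_flagU; congr act.
by apply: funext => p; rewrite expr1n mul1r.
Qed.

Lemma polymap_flag_param T : polymap T -> polymap (flag_param T).
Proof.
move=> hT; apply: polymap_adj_act => // i j.
have H : polyfun (fun w => frame (v4 1 0 0 0) (v4 0 1 0 0)
  (v4 (w 11%N) (w 12%N) 1 0) (v4 (w 13%N) (w 14%N) (w 10%N) 1) j i).
  by elim/ord4_ind: i; elim/ord4_ind: j; first [exact: pf_coord|exact: pf_const].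
by apply: eq_polyfun H => w; rewrite mxE.
Qed.

Lemma polymap_extend0 d : polymap (@extend0 d).
Proof. by move=> n; rewrite /extend0; case: insub => [i|]; [exact: pf_coord|exact: pf_const]. Qed.

Definition flag_stable (p : 'M[F]_4) :=
  [/\ p o0 o2 = 0, p o0 o3 = 0, p o1 o2 = 0, p o1 o3 = 0 & p o2 o3 = 0].

Lemma flag_stable_inv p : p \in unitmx -> flag_stable p -> flag_stable (invmx p).
Proof.
move=> up [p02 p03 p12 p13 p23].
have H k l : (invmx p *m p) k l = (k == l)%:R by rewrite mulVmx // mxE.
have E k l : invmx p k o0 * p o0 l + invmx p k o1 * p o1 l + invmx p k o2 * p o2 l +
    invmx p k o3 * p o3 l = (k == l)%:R by rewrite -H mxE sum4.
have E3 k : invmx p k o3 * p o3 o3 = (k == o3)%:R by rewrite -E p03 p13 p23; ring.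
have n3 : p o3 o3 != 0.
  by apply/eqP => p0; have := E3 o3; rewrite p0 mulr0 => /eqP; rewrite eq_sym oner_eq0.
have Z k : k != o3 -> invmx p k o3 = 0.
  by move=> /negbTE ko; apply: (mulIf n3); rewrite E3 ko mul0r.
have E2 k : k != o3 -> invmx p k o2 * p o2 o2 = (k == o2)%:R.
  by move=> k3; rewrite -E p02 p12 (Z k) //; ring.
have n2 : p o2 o2 != 0.
  by apply/eqP => p0; have := E2 o2 isT; rewrite p0 mulr0 => /eqP; rewrite eq_sym oner_eq0.
by split; rewrite ?Z //; apply: (mulIf n2); rewrite E2 // mul0r.
Qed.

Lemma act_flag_entry (p : 'M[F]_4) (T : structure F 4) i j k : act p T (i, j, k) =
  appm p (mulS T (fun l => invmx p l i) (fun l => invmx p l j)) k.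
Proof. by congr (appm p (mulS T _ _) k); apply: funext => l; rewrite appm_basis. Qed.

(** With A the whole space, [T14] consists of all products with A A in <e_3, e_4>, <e_3, e_4> A in
    <e_4>, A <e_3, e_4> = 0 and e_4 A = 0; these conditions mention only the flag. *)
Lemma T14_flag_act (p : 'M[F]_4) w : p \in unitmx -> flag_stable p ->
  exists w', act p (T14 w) = T14 w'.
Proof.
move=> up fp; have [p02 p03 p12 p13 p23] := fp.
have [q02 q03 q12 q13 q23] := flag_stable_inv up fp.
pose n i j k := appm p (mulS (T14 w) (fun l => invmx p l i) (fun l => invmx p l j)) k.
exists (of_seq [:: n o0 o0 o2; n o0 o0 o3; n o0 o1 o2; n o0 o1 o3; n o1 o0 o2; n o1 o0 o3;
  n o1 o1 o2; n o1 o1 o3; n o2 o0 o3; n o2 o1 o3]).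
apply: eq_structure4 => i j k; rewrite act_flag_entry -/(n i j k).
elim/ord4_ind: i; elim/ord4_ind: j; elim/ord4_ind: k; rewrite /of_seq /=; try reflexivity;
  rewrite /n !mulS_T14 /appm !sum4 /v4 /= ?p02 ?p03 ?p12 ?p13 ?p23 ?q02 ?q03 ?q12 ?q13 ?q23;
  by ring.
Qed.

(** [T12] consists of the products for which e_4 annihilates on both sides and which, modulo e_4,
    are alternating on the quotient by <e_3, e_4> with values in <e_3>; again only the flag
    matters. *)
Lemma T12_flag_act (p : 'M[F]_4) w : p \in unitmx -> flag_stable p ->
  exists w', act p (T12 w) = T12 w'.
Proof.
move=> up fp; have [p02 p03 p12 p13 p23] := fp.
have [q02 q03 q12 q13 q23] := flag_stable_inv up fp.
pose n i j k := appm p (mulS (T12 w) (fun l => invmx p l i) (fun l => invmx p l j)) k.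
exists (of_seq [:: n o0 o0 o3; n o0 o1 o2; n o0 o1 o3; n o1 o0 o3; n o1 o1 o3; n o0 o2 o3;
  n o2 o0 o3; n o1 o2 o3; n o2 o1 o3; n o2 o2 o3]).
apply: eq_structure4 => i j k; rewrite act_flag_entry -/(n i j k).
elim/ord4_ind: i; elim/ord4_ind: j; elim/ord4_ind: k; rewrite /of_seq /=; try reflexivity;
  rewrite /n !mulS_T12 /appm !sum4 /v4 /= ?p02 ?p03 ?p12 ?p13 ?p23 ?q02 ?q03 ?q12 ?q13 ?q23;
  by ring.
Qed.

Lemma flag_factorization (g : 'M[F]_4) : g \in unitmx ->
  (g o2 o2 * g o3 o3 - g o2 o3 * g o3 o2) * g o3 o3 != 0 ->
  exists w p, [/\ g = flagU w *m p, p \in unitmx & flag_stable p].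
Proof.
move=> ug; rewrite mulf_eq0 negb_or; set m := _ - _ => /andP[m0 n0].
(* Column operations on the last two columns of g: the combination [a] has entries 1 and 0 in rows
   e_3 and e_4, and [b] has entry 1 in row e_4, which are the last two columns of [flagU]. *)
pose a k := (g o3 o3 * g k o2 - g o3 o2 * g k o3) / m.
pose b k := g k o3 / g o3 o3.
exists (of_seq [:: 0; 0; 0; 0; 0; 0; 0; 0; 0; 0; b o2; a o0; a o1; b o0; b o1]).
set U := flagU _; exists (invmx U *m g).
have uU : U \in unitmx by apply: flagU_unit.
have up : invmx U *m g \in unitmx by rewrite unitmx_mul unitmx_inv uU.
split=> //; first by rewrite mulKVmx.
have c3 : appm U (v4 0 0 0 (g o3 o3)) = fun k => g k o3.
  apply: funext => k; rewrite /appm sum4 !mxE /frame /v4 /of_seq /= /b.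
  by elim/ord4_ind: k; rewrite /=; field.
have c2 : appm U (v4 0 0 (m / g o3 o3) (g o3 o2)) = fun k => g k o2.
  apply: funext => k; rewrite /appm sum4 !mxE /frame /v4 /of_seq /= /a /b.
  elim/ord4_ind: k; rewrite /=; first [by field; rewrite ?n0 ?m0|idtac].
  by rewrite /m; field.
have col l k : (invmx U *m g) k l = appm (invmx U) (fun k => g k l) k by rewrite mxE.
by split; rewrite col -?c3 -?c2 appmK.
Qed.

Definition flag_range T nu := exists v : 'I_15 -> F, nu = flag_param T (extend0 v).

Lemma flag_range_orbit T w0 :
  (forall c w, exists w', (fun p => c * T w p) = T w') ->
  (forall p w, p \in unitmx -> flag_stable p -> exists w', act p (T w) = T w') ->
  (forall w w', (forall n, (n < 10)%N -> w n = w' n) -> T w = T w') ->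
  forall nu, gl_orbit (T w0) nu -> zclosure (flag_range T) nu.
Proof.
move=> Tscale Tflag Tdep.
apply: (@zclosure_cell _ (fun y => (y (o2, o2) * y (o3, o3) - y (o2, o3) * y (o3, o2)) * y (o3, o3))
  (fun p => (1%:M : 'M[F]_4) p.1 p.2)).
- by do ![apply: pf_mul|apply: polyfun_sub]; apply: pf_coord.
- by rewrite /= !mxE /= !(mulr1, mulr0, subr0) oner_eq0.
move=> g c ug /= hg; have [u [p [-> up fp]]] := flag_factorization ug hg.
have [w1 ->] := Tscale c w0.
rewrite -act_comp ?flagU_unit //; have [w2 ->] := Tflag p w1 up fp.
pose s := [:: w2 0%N; w2 1%N; w2 2%N; w2 3%N; w2 4%N; w2 5%N; w2 6%N; w2 7%N; w2 8%N; w2 9%N;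
  u 10%N; u 11%N; u 12%N; u 13%N; u 14%N].
exists (fun i => of_seq s i); rewrite extend0_of_seq // flag_paramE.
by congr act; apply: Tdep; do 10![case=> //].
Qed.

Lemma T14_dep w w' : (forall n, (n < 10)%N -> w n = w' n) -> T14 w = T14 w'.
Proof. by move=> H; apply: eq_structure4; do 3![elim/ord4_ind]; rewrite /= ?H. Qed.

Lemma T12_dep w w' : (forall n, (n < 10)%N -> w n = w' n) -> T12 w = T12 w'.
Proof. by move=> H; apply: eq_structure4; do 3![elim/ord4_ind]; rewrite /= ?H. Qed.

Lemma clM14_sub_flag : subset_of C3 (zclosure (flag_range (@T14 F))).
Proof.
apply: zclosure_min; first exact: zclosed_zclosure.
move=> nu [a]; rewrite M14_T14; apply: flag_range_orbit; last exact: T14_dep.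
- move=> c w; exists (fun n => c * w n).
  by apply: eq_structure4; do 3![elim/ord4_ind]; rewrite /= ?mulr0.
- by move=> p w; apply: T14_flag_act.
Qed.

Lemma clM12_sub_flag : subset_of C2 (zclosure (flag_range (@T12 F))).
Proof.
apply: zclosure_min; first exact: zclosed_zclosure.
move=> nu [a]; rewrite M12_T12; apply: flag_range_orbit; last exact: T12_dep.
- move=> c w; exists (fun n => c * w n).
  by apply: eq_structure4; do 3![elim/ord4_ind]; rewrite /= ?mulr0 ?mulrN.
- by move=> p w; apply: T12_flag_act.
Qed.

Lemma zchain_component_leq Y d : zcomponent X Y -> zchain Y d -> (d <= 15)%N.
Proof.
move=> /zcomponentP YE; rewrite -(card_ord 15).
case: YE => [->|[->|->]].
- by apply: zchain_image_leq clL2_sub_rank1; apply: polymap_comp polymap_rank1 (polymap_extend0 _).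
- apply: zchain_image_leq clM12_sub_flag; apply: polymap_comp (polymap_extend0 _).
  exact/polymap_flag_param/polymap_T12.
- apply: zchain_image_leq clM14_sub_flag; apply: polymap_comp (polymap_extend0 _).
  exact/polymap_flag_param/polymap_T14.
Qed.

(** * A chain of length 15 in the closure of M14 *)

Definition trunc k w : nat -> F := fun n => if (n < k)%N then w n else 0.

Definition flag_stratum k nu := exists w, nu = flag_param (@T14 F) (trunc k w).

(* [flag_test k] vanishes on [flag_stratum k], whose parameters have [w k = 0], but not on
   [flag_stratum k.+1]. *)
Definition flag_test (k : nat) nu : F :=
  match k with
  | 0 => nu (o0, o0, o2) | 1 => nu (o0, o0, o3) | 2 => nu (o0, o1, o2) | 3 => nu (o0, o1, o3)
  | 4 => nu (o1, o0, o2) | 5 => nu (o1, o0, o3) | 6 => nu (o1, o1, o2) | 7 => nu (o1, o1, o3)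
  | 8 => nu (o2, o0, o3) | 9 => nu (o2, o1, o3) | 10 => nu (o2, o0, o2)
  | 11 => nu (o0, o0, o0) | 12 => nu (o0, o0, o1)
  | 13 => rpow nu (e_ o0) 2 o0 | _ => rpow nu (e_ o0) 2 o1 end.

Definition flag_test_value (k : nat) w : F :=
  w k * match k with 10 => w 8%N | 11 | 12 => w 0%N | 13 | 14 => w 0%N * w 8%N | _ => 1 end.

(** For k <= 9 the unipotent matrix U is the identity and a structure constant is read off. Beyond,
    U fixes e_1, and e_3 e_1, e_1 e_1 and (e_1 e_1) e_1 become U applied to elements of <e_3, e_4>,
    whose first three coordinates reveal the entries of U multiplied by w 0 or w 8. *)
Lemma flag_testE k w : (k < 15)%N -> (forall n, (k < n)%N -> w n = 0) ->
  flag_test k (flag_param (@T14 F) w) = flag_test_value k w.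
Proof.
move=> k15 wk; rewrite flag_paramE.
have uU := flagU_unit w.
have U0 : appm (flagU w) (e_ o0) = e_ o0.
  by apply: funext => l; rewrite appm_basis mxE; elim/ord4_ind: l.
have sq : mulS (act (flagU w) (T14 w)) (e_ o0) (e_ o0) = appm (flagU w) (mulS (T14 w) (e_ o0) (e_ o0)).
  by rewrite act_hom // U0.
have rp : rpow (act (flagU w) (T14 w)) (e_ o0) 2 = appm (flagU w) (rpow (T14 w) (e_ o0) 2).
  by rewrite -rpow_act // U0.
have U1 : (k <= 9)%N -> flagU w = 1%:M.
  move=> k9; apply/matrixP => i j; rewrite !mxE /frame /v4.
  by elim/ord4_ind: i; elim/ord4_ind: j; rewrite /= ?wk // (leq_ltn_trans k9).
case: k k15 wk U1 => [|[|[|[|[|[|[|[|[|[|[|[|[|[|[|//]]]]]]]]]]]]]]] _ wk U1;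
  rewrite /flag_test /flag_test_value.
1-10: by rewrite U1 // act1 /= mulr1.
- have U2 : appm (flagU w) (e_ o2) = e_ o2.
    by apply: funext => l; rewrite appm_basis mxE; elim/ord4_ind: l; rewrite /frame /v4 /= ?wk.
  rewrite -mulS_basis -{1}U2 -{1}U0 -act_hom // mulS_T14 /appm sum4 !mxE /frame /v4 /basis_vec /=.
  by ring.
- rewrite -mulS_basis sq mulS_T14 /appm sum4 !mxE /frame /v4 /basis_vec /= (wk 13%N) //.
  by ring.
- rewrite -mulS_basis sq mulS_T14 /appm sum4 !mxE /frame /v4 /basis_vec /= (wk 14%N) //.
  by ring.
- rewrite rp /= !mulS_T14 /appm sum4 !mxE /frame /v4 /basis_vec /=; by ring.
- rewrite rp /= !mulS_T14 /appm sum4 !mxE /frame /v4 /basis_vec /=; by ring.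
Qed.

Lemma polyfun_flag_test k : polyfun (flag_test k).
Proof.
have hp : polymap (fun nu => rpow nu (e_ o0) 2).
  by apply: polymap_rpow; [exact: polymap_id|exact: polymap_cst].
rewrite /flag_test; do 15?[case: k => [|k]]; first [exact: pf_coord|exact: hp].
Qed.

Lemma polymap_trunc k : polymap (trunc k).
Proof. by move=> n; rewrite /trunc; case: ltnP => _; [exact: pf_coord|exact: pf_const]. Qed.

Lemma trunc_trunc k w : trunc k.+1 (trunc k w) = trunc k w.
Proof.
apply: funext => n; rewrite /trunc; case: (ltnP n k) => nk; last by rewrite if_same.
by rewrite ltnS ltnW.
Qed.

Lemma zchain_clM14 : zchain C3 15.
Proof.
exists (fun k => zclosure (flag_stratum k)); split; last split.
- move=> k _.
  have := @zirreducible_image F _ nat (fun w => flag_param (@T14 F) (trunc k w)) (fun _ => 1) (fun _ => 0).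
  move=> /(_ (polymap_comp (polymap_flag_param (polymap_T14 F)) (polymap_trunc k)) (pf_const _ 1)).
  move=> /(_ (oner_neq0 F)); apply: zirreducible_zclosure_eq => nu; split.
    by move=> [w _ ->]; exists w.
  by move=> [w ->]; exists w => //; apply: oner_neq0.
- move=> k k15; split.
    apply: zclosure_min; first exact: zclosed_zclosure.
    by move=> _ [w ->]; apply: sub_zclosure; exists (trunc k w); rewrite trunc_trunc.
  (* Besides w k, the parameters w 0 and w 8 are set to 1 because they occur as factors in
     [flag_test_value]. *)
  pose w n : F := (n \in [:: k; 0%N; 8%N])%:R.
  pose nu := flag_param (@T14 F) (trunc k.+1 w).
  have E (v : nat -> F) : flag_test k (flag_param (@T14 F) (trunc k.+1 v)) =
      flag_test_value k (trunc k.+1 v).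
    by apply: flag_testE => // n kn; rewrite /trunc ltnS leqNgt kn.
  have Znu : zclosure (flag_stratum k.+1) nu by apply: sub_zclosure; exists w.
  move=> EZ; move: Znu; rewrite -EZ => /zclosureP /(_ _ (polyfun_flag_test k)).
  move=> H; have : flag_test k nu = 0.
    apply: H => _ [v ->]; rewrite -trunc_trunc E // /flag_test_value.
    by rewrite /trunc ltnSn ltnn mul0r.
  rewrite /nu E // /flag_test_value /trunc /w ltnSn inE eqxx mul1r /= => /eqP.
  move: k15; clear; do 15?[case: k => [|k]] => //= _;
    by rewrite ?inE /= ?mulr1 oner_eq0.
- apply: zclosure_min; first exact: zclosed_zclosure.
  move=> _ [w ->]; rewrite flag_paramE; apply: (@T14_closure _ (trunc 15 w)).
  by exists (flagU (trunc 15 w)); rewrite flagU_unit.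
Qed.

End Dimension.

Theorem theoremF (R : realType) :
  let X := @NilMonoLeib R[i] 4 in
  let C1 := family_orbit_closure (fun _ : unit => L2 R[i]) in
  let C2 := family_orbit_closure (@M12 R[i]) in
  let C3 := family_orbit_closure (@M14 R[i]) in
  zdim X 15 /\
  (forall Y, zcomponent X Y <-> (Y = C1 \/ Y = C2 \/ Y = C3)) /\
  C1 <> C2 /\ C1 <> C3 /\ C2 <> C3 /\
  (exists mu, rigid_in X mu /\
     forall nu, rigid_in X nu -> gl_orbit mu nu).
Proof.
move=> X C1 C2 C3; split.
  split; last by move=> Y d XY [Yd _]; apply: zchain_component_leq XY Yd.
  have XC3 : zcomponent X C3 by apply/zcomponentP; right; right.
  exists C3; split=> //; split; first exact: zchain_clM14.
  by move=> /(zchain_component_leq XC3).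
split; first by move=> Y; apply: zcomponentP.
split; first by move=> E; apply: (@clL2_nsub_clM12 R[i]) => mu; rewrite -/C1 -/C2 E.
split; first by move=> E; apply: (@clL2_nsub_clM14 R[i]) => mu; rewrite -/C1 -/C3 E.
split; first by move=> E; apply: (@clM12_nsub_clM14 R[i]) => mu; rewrite -/C2 -/C3 E.
exists (L2 R[i]); split; first exact: rigid_L2.
by move=> nu; apply: rigid_orbit_L2.
Qed.
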